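(* Let $X$ and $Y$ be separable locally compact metrizable topological spaces, and let $\phi: X \to X$, $\varphi: Y \to Y$ and $\pi: X \to Y$ be continuous proper maps such that $\pi \circ \phi = \varphi \circ \pi$. Then $$h(\phi) \leq h(\varphi) + \sup_{y \in Y} h_{d_X}\left(\phi, \pi^{-1}(y)\right),$$ where $d_X$ is a distance on $X$ induced by a distance of the one-point compactification of $X$. Moreover, if $\pi: X \to Y$ is a $T$-principal bundle, where $T$ is a compact group, and there exists $\tau: T \to T$ such that $$\phi(xt) = \phi(x)\tau(t)$$ for all $x \in X$ and $t \in T$, then $$h(\phi) \leq h(\varphi) + h(\tau).$$
   Context: For a continuous map $S: Z \to Z$ of a separable locally compact metrizable space, $h(S) \in [0,\infty]$ denotes the topological entropy of $S$ (the generalization of the Adler–Konheim–McAndrew entropy to locally compact metrizable spaces). It is characterized by the variational principle $h(S) = \sup_\mu h_\mu(S)$, the supremum being over all $S$-invariant Borel probability measures $\mu$ on $Z$ (with value $0$ if there are none), where $h_\mu(S)$ is the Kolmogorov–Sinai entropy; this may be taken as the definition. When $Z$ is compact it is the usual topological entropy. For a distance $d$ on $Z$ and a compact subset $K \subset Z$, $h_d(S,K)$ is Bowen's entropy $$h_d(S,K) = \lim_{\varepsilon \to 0} \limsup_{n \to \infty} \frac{1}{n} \log s_n^S(\varepsilon, K),$$ where $s_n^S(\varepsilon,K)$ is the smallest cardinality of an $(n,\varepsilon)$-spanning set of $K$ for $S$, i.e. a set $F$ such that for each $x \in K$ there is $z \in F$ with $d(S^k(x),S^k(z)) < \varepsilon$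 for all $0 \leq k < n$. A map is proper if preimages of compact sets are compact. A $T$-principal bundle $\pi: X \to Y$ carries a continuous free right action $X \times T \to X$, $(x,t) \mapsto xt$, of $T$ whose orbits are the fibers of $\pi$. *)

(* Defs.v *)
From HB Require Import structures.
From mathcomp Require Import all_boot all_order all_algebra.
From mathcomp Require Import all_classical all_reals all_analysis.

Set Implicit Arguments.
Unset Strict Implicit.
Unset Printing Implicit Defensive.

Import Order.TTheory GRing.Theory Num.Theory.
Import numFieldNormedType.Exports.

Local Open Scope classical_set_scope.
Local Open Scope ring_scope.

(* Supremum in [0, +oo]: the supremum of the empty set is 0. *)
Definition nneg_ereal_sup (R : realType) (A : set (\bar R)) : \bar R :=
  ereal_sup ([set 0%E] `|` A).

Section Spaces.
Context {R : realType}.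

Definition is_distance (Z : Type) (d : Z -> Z -> R) : Prop :=
  [/\ forall x y, 0 <= d x y,
      forall x y, d x y = 0 <-> x = y,
      forall x y, d x y = d y x &
      forall x y z, d x z <= d x y + d y z].

Definition compatible_distance (Z : topologicalType) (d : Z -> Z -> R) : Prop :=
  is_distance d /\
  forall (x : Z) (A : set Z),
    nbhs x A <-> exists2 e : R, 0 < e & [set y | d x y < e] `<=` A.

Definition metrizable (Z : topologicalType) : Prop :=
  exists d : Z -> Z -> R, compatible_distance d.

(* If Z is compact, its one-point compactification is Z plus an isolated
   point. *)
Definition one_point_distance (Z : topologicalType) (d : Z -> Z -> R) : Prop :=
  exists D : one_point_compactification Z -> one_point_compactification Z -> R,
    compatible_distance D /\ forall x y : Z, d x y = D (Some x) (Some y).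

End Spaces.

Definition separable (Z : topologicalType) : Prop :=
  exists2 D : set Z, countable D & dense D.

Definition sep_lc_metrizable (R : realType) (Z : topologicalType) : Prop :=
  [/\ separable Z, locally_compact [set: Z] & @metrizable R Z].

Definition proper_map (X Y : topologicalType) (f : X -> Y) : Prop :=
  forall K : set Y, compact K -> compact (f @^-1` K).

Section KolmogorovSinai.
Context {R : realType} {d : measure_display} {T : measurableType d}.
Variable mu : probability T R.
Local Open Scope ereal_scope.

Definition finite_measurable_partition (k : nat) (A : 'I_k -> set T) : Prop :=
  partition [set: 'I_k] A [set: T] /\ forall i, measurable (A i).

(* The convention 0 log 0 = 0 holds because lne 0 = -oo and 0 * -oo = 0. *)
Definition partition_entropy (I : finType) (A : I -> set T) : \bar R :=
  - \sum_(i : I) (mu (A i) * lne (mu (A i))).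

(* The common refinement of S^-i A for 0 <= i < n, indexed by itineraries;
   some of its members may be empty. *)
Definition iterated_join (S : T -> T) (k : nat) (A : 'I_k -> set T) (n : nat)
    (w : {ffun 'I_n -> 'I_k}) : set T :=
  \bigcap_(i in [set: 'I_n]) (iter i S @^-1` A (w i)).

Definition entropy_rate (S : T -> T) (k : nat) (A : 'I_k -> set T) : \bar R :=
  limn (fun n : nat =>
    (n%:R^-1)%:E * partition_entropy (@iterated_join S k A n)).

Definition KS_entropy (S : T -> T) : \bar R :=
  ereal_sup [set h | exists (k : nat) (A : 'I_k -> set T),
    finite_measurable_partition A /\ h = entropy_rate S A].

Definition invariant_measure (S : T -> T) : Prop :=
  forall B : set T, measurable B -> mu (S @^-1` B) = mu B.

End KolmogorovSinai.

(* Measurable types are pointed in the library, topological types need not be.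
   A probability measure on Z forces Z to be nonempty, so the Borel structure is
   put on Z pointed at some z0; the choice of z0 is immaterial. *)
Definition pointed_at (Z : topologicalType) (z0 : Z) : Type := Z.

HB.instance Definition _ (Z : topologicalType) (z0 : Z) :=
  Choice.on (pointed_at z0).
HB.instance Definition _ (Z : topologicalType) (z0 : Z) :=
  isPointed.Build (pointed_at z0) z0.

Definition borelType (Z : topologicalType) (z0 : Z) :
    measurableType (sigma_display (@open Z)) :=
  Measurable.clone _ (g_sigma_algebraType (@open Z : set (set (pointed_at z0))))
    _.

Definition topological_entropy (R : realType) (Z : topologicalType)
    (S : Z -> Z) : \bar R :=
  nneg_ereal_sup [set h | exists (z0 : Z) (mu : probability (borelType z0) R),
    invariant_measure mu S /\ h = KS_entropy mu S].

Section Bowen.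
Context {R : realType} {Z : choiceType}.
Variables (d : Z -> Z -> R) (S : Z -> Z).

Definition spanning_set (n : nat) (e : R) (K F : set Z) : Prop :=
  forall x, K x -> exists2 z, F z &
    forall k, (k < n)%N -> d (iter k S x) (iter k S z) < e.

(* The value is +oo when there is no finite spanning set. *)
Definition spanning_number (n : nat) (e : R) (K : set Z) : \bar R :=
  ereal_inf [set (m%:R)%:E | m in
    [set m : nat | exists F : set Z, (F #= `I_m)%card /\ spanning_set n e K F]].

Definition bowen_entropy (K : set Z) : \bar R :=
  lim ((limn_esup (fun n : nat =>
          (n%:R^-1)%:E * lne (spanning_number n e K))%E) @[e --> 0^'+]).

End Bowen.

HB.structure Definition PreTopologicalGroup :=
  {G of Topological G & Group G}.

HB.mixin Record isTopologicalGroup G & PreTopologicalGroup G := {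
  mulg_continuous : continuous (fun p : G * G => (p.1 * p.2)%g);
  invg_continuous : continuous (fun x : G => (x^-1)%g)
}.

#[short(type="topologicalGroupType")]
HB.structure Definition TopologicalGroup :=
  {G of PreTopologicalGroup G & isTopologicalGroup G}.

Record principal_bundle (T : topologicalGroupType) (X Y : topologicalType)
    (act : X -> T -> X) (pi : X -> Y) : Prop := PrincipalBundle {
  pb_act1 : forall x, act x 1%g = x;
  pb_actM : forall x s t, act (act x s) t = act x (s * t)%g;
  pb_continuous : continuous (fun p : X * T => act p.1 p.2);
  pb_free : forall x t, act x t = x -> t = 1%g;
  pb_surjective : forall y, exists x, pi x = y;
  pb_fiber : forall x, pi @^-1` [set pi x] = [set act x t | t in [set: T]]
}.

(* Main.v *)
(** The proof uses only entropies of finite partitions. Let mu be phi-invariant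
    and A a finite partition of X. Choose compact sets K_i in the cells A_i with
    complement K_0 of small measure, and let D be the partition into the cells
    A_i cap K_0 and the complement of K_0; it has small entropy. Bowen's
    argument gives finitely many open subsets of Y covering pi(K_1 u ... u K_k)
    over each of which X is covered by about exp(b n) sets on which the A-name
    of length n is determined by the D-name. With C the partition of Y generated
    by these open sets, each pair of a C-name and a D-name of length n is
    compatible with at most exp(b (n + M)) A-names, so that
    h(phi, A) <= h(varphi, C) + H(D) + b. Because the visits to K_0 are recorded
    by D, no factor 2^n occurs and no power of phi has to be taken.

    For a principal bundle, phi (x t) = phi(x) tau(t) reduces the covers of the
    fibres to covers of T by Bowen balls of tau. These are few because
    h(tau), defined by invariant measures, bounds the growth of separated sets:
    this is Misiurewicz's proof of the variational principle, the invariant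
    measure being obtained from an ultrafilter limit of averaged uniform
    measures, which is a finitely additive measure on all subsets of T. *)

Require Import Defs.
From HB Require Import structures.
From mathcomp Require Import all_boot all_order all_algebra.
From mathcomp Require Import all_classical all_reals all_analysis.
From mathcomp Require Import ring lra zify.

Set Implicit Arguments.
Unset Strict Implicit.
Unset Printing Implicit Defensive.

Import Order.TTheory GRing.Theory Num.Theory.
Import numFieldNormedType.Exports.

Local Open Scope classical_set_scope.
Local Open Scope ring_scope.

(** * Finite entropy *)

Section FiniteEntropy.
Context {R : realType}.
Implicit Types (I J K : finType).

(** Entropy is here a supremum over measures, whereas fibres are controlled by counting orbit
    pieces. The two meet in one inequality: if each cell of g meets at most C cells of f, then H(f)
    <= H(g) + ln C. Arbitrary cells can touch, so closeness of orbits says nothing about A-names.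
    The disjoint compacts K_i lie at positive distance from each other, and closeness then decides
    which of them is visited. The time for which a fibre is well covered depends on the fibre.
    Orbits are therefore cut into blocks of varying length, bounded by M, and the last block may
    overrun; this is the term b M. The ultrafilter limit is defined on all subsets but is only
    finitely additive. The Borel measure built from it is known to agree with it only on sets with
    null boundary, so the partition used is generated by balls whose spheres are null. In a bundle,
    the iterates of a fibre move to orbits of other points, where distances cannot be compared with
    those at the start. The group element carrying one iterate to the other does not depend on the
    base point and takes the place of the distance. *)

Definition eta (x : R) : R := - (x * ln x).

Lemma eta0 : eta 0 = 0.
Proof. by rewrite /eta mul0r oppr0. Qed.

Lemma eta_ge0 (x : R) : 0 <= x -> x <= 1 -> 0 <= eta x.
Proof. by move=> x0 x1; rewrite /eta -mulrN mulr_ge0// oppr_ge0 ln_le0. Qed.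

Lemma ln_leB1 (u : R) : 0 < u -> ln u <= u - 1.
Proof.
move=> u0; have := @le_ln1Dx R (u - 1); rewrite addrCA subrr addr0; apply.
by rewrite ltrBDr addNr.
Qed.

(* Tangent line inequality for the concave function [eta]. *)
Lemma eta_gibbs (x y : R) : 0 <= x -> 0 < y ->
  eta x <= - (x * ln y) + (y - x).
Proof.
move=> x0 y0; move: x0; rewrite le_eqVlt => /predU1P[<-|x0].
  by rewrite eta0 mul0r oppr0 add0r addr0 ltW.
have := ln_leB1 (divr_gt0 y0 x0); rewrite ln_div ?posrE// => h.
have : x * (ln y - ln x) <= x * (y / x - 1) by rewrite ler_pM2l.
rewrite mulrBr mulrBr mulr1 mulrCA divff ?gt_eqF// mulr1 /eta; lra.
Qed.

Lemma eta_sum_le (K : finType) (A : pred K) (p : K -> R) :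
  (forall k, 0 <= p k) ->
  eta (\sum_(k | A k) p k) <= \sum_(k | A k) eta (p k).
Proof.
move=> p0; rewrite {1}/eta mulr_suml -sumrN; apply: ler_sum => k Ak.
rewrite /eta lerN2; have := p0 k; rewrite le_eqVlt => /predU1P[<-|pk].
  by rewrite !mul0r.
rewrite ler_pM2l// ler_ln ?posrE//; last first.
- by rewrite (bigD1 k)//= ltr_pwDl// sumr_ge0.
- by rewrite (bigD1 k)//= lerDl sumr_ge0.
Qed.

(** Tangent at [s / C], the weight of a cell when the mass [s] is spread evenly over [C] cells; the
    linear terms sum to at most 0 because [#|A| * (s / C) <= s]. A real [C] allows exponential
    counts. *)
Lemma sum_eta_le (K : finType) (A : pred K) (C : R) (p : K -> R) : 0 < C ->
  (forall k, 0 <= p k) -> #|A|%:R <= C ->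
  \sum_(k | A k) eta (p k) <=
  eta (\sum_(k | A k) p k) + (\sum_(k | A k) p k) * ln C.
Proof.
move=> C0 p0 AC; set s := \sum_(k | A k) p k.
have s0 : 0 <= s by exact: sumr_ge0.
move: (s0); rewrite le_eqVlt => /predU1P[se|sp].
  rewrite -se eta0 mul0r addr0 big1// => k Ak.
  suff -> : p k = 0 by rewrite eta0.
  apply/eqP; rewrite eq_le p0 andbT se /s (bigD1 k)//= lerDl.
  by rewrite sumr_ge0.
have h k : A k -> eta (p k) <= - (p k * ln (s / C)) + (s / C - p k).
  by move=> _; apply: eta_gibbs => //; rewrite divr_gt0.
apply: le_trans (ler_sum _ h) _.
rewrite big_split/= sumrN -mulr_suml -/s sumrB -/s sumr_const.
rewrite ln_div ?posrE// mulrBr /eta.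
suff : s / C *+ #|A| <= s by move=> ?; lra.
by rewrite -mulr_natr -mulrA ler_piMr// mulrC ler_pdivrMr// mul1r.
Qed.

(** Jensen's inequality: tangent at the mean [y], whose linear terms cancel on summation. At mean 0
    there is no tangent, but then every [x i] vanishes. *)
Lemma eta_average_ge (n : nat) (x : 'I_n -> R) : (0 < n)%N ->
  (forall i, 0 <= x i) ->
  n%:R^-1 * (\sum_(i < n) eta (x i)) <= eta (n%:R^-1 * \sum_(i < n) x i).
Proof.
move=> n0 x0; have nR : 0 < n%:R :> R by rewrite ltr0n.
set y := n%:R^-1 * \sum_(i < n) x i.
have sy : \sum_(i < n) x i = n%:R * y by rewrite /y mulrA divff ?gt_eqF// mul1r.
have y0 : 0 <= y by rewrite mulr_ge0 ?invr_ge0 ?sumr_ge0// ltW.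
rewrite mulrC ler_pdivrMr//; move: y0; rewrite le_eqVlt => /predU1P[ye|yp].
  rewrite -ye eta0 mul0r big1// => i _.
  suff -> : x i = 0 by rewrite eta0.
  apply/eqP; rewrite eq_le x0 andbT.
  have : \sum_(i < n) x i = 0 by rewrite sy -ye mulr0.
  rewrite (bigD1 i)//= => /eqP; rewrite paddr_eq0 ?sumr_ge0//.
  by move=> /andP[/eqP-> _].
apply: le_trans (ler_sum _ (fun i _ => eta_gibbs (x0 i) yp)) _.
rewrite big_split/= sumrN -mulr_suml sy sumrB sy sumr_const card_ord /eta.
by rewrite -[y *+ n]mulr_natl le_eqVlt; apply/orP; left; apply/eqP; ring.
Qed.

Lemma continuous_eta_right0 (e : R) : 0 < e ->
  exists2 d : R, 0 < d & forall x, 0 <= x -> x < d -> eta x < e.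
Proof.
move=> e0; exists (Num.min (1/4) (e ^+ 2 / 16)).
  by rewrite lt_min divr_gt0//= divr_gt0// exprn_gt0.
move=> x x0; rewrite lt_min => /andP[x1 x2].
move: x0; rewrite le_eqVlt => /predU1P[<-|x0]; first by rewrite eta0.
(* [-x ln x = 2 x ln (1 / sqrt x) <= 2 sqrt x] *)
set s := Num.sqrt x; have s0 : 0 < s by rewrite sqrtr_gt0.
have xs : x = s ^+ 2 by rewrite sqr_sqrtr// ltW.
have ls : - ln s <= s^-1.
  by rewrite -lnV ?posrE//; apply/ltW/ln_sublinear; rewrite invr_gt0.
have : eta x <= 2 * s.
  rewrite /eta xs lnXn// mulr2n.
  have : s ^+ 2 * (- ln s) <= s ^+ 2 * s^-1 by rewrite ler_pM2l ?exprn_gt0.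
  rewrite expr2 -[s * s * s^-1]mulrA divff ?gt_eqF// mulr1; lra.
move=> /le_lt_trans; apply.
have : s < e / 4.
  rewrite -(@ltr_pXn2r _ 2) ?nnegrE ?(ltW s0)// -?xs; last first.
    by rewrite divr_ge0// ltW.
  by rewrite expr_div_n (_ : 4 ^+ 2 = 16)// -natrX.
lra.
Qed.

(** Stated along an arbitrary filter because it is applied to limits along an ultrafilter. The point
    0 is included since a cell may lose all its mass in the limit. *)
Lemma continuous_eta : {in [pred x | 0 <= x], forall x : R,
  forall (F : set_system nat) (u : nat -> R), ProperFilter F ->
   (forall n, 0 <= u n) -> u @ F --> x -> (eta \o u) @ F --> eta x}.
Proof.
move=> x; rewrite inE/= le_eqVlt => /predU1P[<-|x0] F u PF u0 ux; last first.
  apply: cvgN; apply: cvgM => //; apply: continuous_cvg => //.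
  exact: continuous_ln.
rewrite eta0; apply/cvgrPdist_lt => e e0.
have [d d0 hd] := continuous_eta_right0 e0.
have dm : 0 < Num.min d 1 by rewrite lt_min d0 ltr01.
near=> n; rewrite sub0r normrN /=.
have : `|u n| < Num.min d 1.
  by near: n; move/cvgrPdist_lt : ux => /(_ _ dm); under eq_near do rewrite sub0r normrN.
rewrite ger0_norm// lt_min => /andP[ud u1].
by rewrite ger0_norm ?hd// eta_ge0// ltW.
Unshelve. all: by end_near. Qed.

End FiniteEntropy.

(** The algebra [M] is a parameter: the same entropy calculus serves for Borel sets, for all
    subsets, and for sets with null boundary. *)
Record finitely_additive (R : realType) (T : Type) (M : set T -> Prop)
    (P : set T -> R) : Prop := FinitelyAdditive {
  fa_measT : M setT;
  fa_measC : forall A, M A -> M (~` A);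
  fa_measI : forall A B, M A -> M B -> M (A `&` B);
  fa_ge0 : forall A, M A -> 0 <= P A;
  fa_total : P setT = 1;
  fa_add : forall A B, M A -> M B -> A `&` B = set0 ->
    P (A `|` B) = P A + P B
}.

(** A partition is given by the function naming the cell of each point, so that refinement is
    pairing and coarsening is composition. Unattained labels are harmless, having mass 0. *)
Definition label (T I : Type) (M : set T -> Prop) (f : T -> I) :=
  forall i, M (f @^-1` [set i]).

Definition entropy {R : realType} (T : Type) (I : finType) (P : set T -> R)
    (f : T -> I) : R :=
  \sum_i eta (P (f @^-1` [set i])).

Section FinitelyAdditiveEntropy.
Context {R : realType} {T : Type} (M : set T -> Prop) (P : set T -> R).
Hypothesis PM : finitely_additive M P.
Implicit Types (I J : finType).

Lemma fa_meas0 : M set0.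
Proof. by rewrite -setCT; apply: (fa_measC PM); exact: fa_measT PM. Qed.

Lemma fa_measU A B : M A -> M B -> M (A `|` B).
Proof.
move=> MA MB; rewrite -[A `|` B]setCK setCU; apply: (fa_measC PM).
by apply: (fa_measI PM); exact: (fa_measC PM).
Qed.

Lemma fa_0 : P set0 = 0.
Proof.
have := fa_add PM fa_meas0 fa_meas0 (setI0 _).
by rewrite setU0 => /eqP; rewrite -subr_eq0 opprD addNKr oppr_eq0 => /eqP.
Qed.

Lemma fa_le A B : M A -> M B -> A `<=` B -> P A <= P B.
Proof.
move=> MA MB AB; rewrite -(setDUK AB) (fa_add PM)//.
- by rewrite lerDl (fa_ge0 PM)// setDE; apply: (fa_measI PM) => //; exact: fa_measC PM _ _.
- by rewrite setDE; apply: (fa_measI PM) => //; exact: fa_measC PM _ _.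
- by rewrite setDIK.
Qed.

Lemma fa_le1 A : M A -> P A <= 1.
Proof. by move=> MA; rewrite -(fa_total PM) fa_le//; exact: fa_measT PM. Qed.

Lemma fa_seq I (f : T -> I) (s : seq I) : label M f -> uniq s ->
  M (f @^-1` [set` s]) /\
  P (f @^-1` [set` s]) = \sum_(i <- s) P (f @^-1` [set i]).
Proof.
move=> Mf; elim: s => [|i s IH]/=.
  move=> _; have -> : f @^-1` [set` [::]] = set0 by rewrite -subset0 => x.
  by rewrite big_nil fa_0; split => //; exact: fa_meas0.
move=> /andP[nis us]; have [IHM IHP] := IH us.
have -> : f @^-1` [set` i :: s] = f @^-1` [set i] `|` f @^-1` [set` s].
  apply/seteqP; split => x /=; rewrite inE; first by case/predU1P; [left|right].
  by case=> [->|->]; rewrite ?eqxx ?orbT.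
split; first exact: fa_measU.
rewrite (fa_add PM)// ?IHP ?big_cons//.
by rewrite -subset0 => x [/= -> xs]; move: nis; rewrite xs.
Qed.

Lemma fa_preimage I (f : T -> I) (B : pred I) : label M f ->
  M (f @^-1` [set i | B i]) /\
  P (f @^-1` [set i | B i]) = \sum_(i | B i) P (f @^-1` [set i]).
Proof.
move=> Mf; have [h1 h2] := fa_seq Mf (enum_uniq B).
have e : [set i | B i] = [set` enum B].
  by apply/seteqP; split => i /=; rewrite mem_enum.
by rewrite e; split => //; rewrite h2 big_enum.
Qed.

Lemma sum_fa_preimage I (f : T -> I) : label M f ->
  \sum_i P (f @^-1` [set i]) = 1.
Proof.
move=> Mf; have [_ <-] := fa_preimage predT Mf; rewrite -(fa_total PM).
by congr P; apply/seteqP; split.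
Qed.

Lemma label_comp I J (f : T -> I) (g : I -> J) : label M f -> label M (g \o f).
Proof.
move=> Mf j; have [+ _] := fa_preimage (fun i => g i == j) Mf.
rewrite (_ : _ @^-1` _ = (g \o f) @^-1` [set j])//.
by apply/seteqP; split => x /= /eqP.
Qed.

Lemma label_pair I J (f : T -> I) (g : T -> J) :
  label M f -> label M g -> label M (fun x => (f x, g x)).
Proof.
move=> Mf Mg [i j]; have := fa_measI PM (Mf i) (Mg j).
rewrite (_ : _ `&` _ = (fun x => (f x, g x)) @^-1` [set (i, j)])//.
by apply/seteqP; split => x /= [-> ->].
Qed.

Lemma entropy_comp_le I J (f : T -> I) (g : I -> J) : label M f ->
  entropy P (g \o f) <= entropy P f.
Proof.
move=> Mf; rewrite /entropy [leRHS](partition_big g predT)//=.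
apply: ler_sum => j _.
have [_] := fa_preimage (fun i => g i == j) Mf.
rewrite (_ : _ @^-1` _ = (g \o f) @^-1` [set j]) => [->|].
  by apply: eta_sum_le => i; exact: (fa_ge0 PM).
by apply/seteqP; split => x /= /eqP.
Qed.

(** In conditional form, H(f | g) <= ln C: inside each cell of [g \o f] the mass is spread over at
    most [C] cells of [f], and [sum_eta_le] applies. *)
Lemma entropy_comp_count I J (f : T -> I) (g : I -> J) (C : R) :
  label M f -> 0 < C ->
  (forall x0, exists2 L : seq I, (size L)%:R <= C &
     forall x, g (f x) = g (f x0) -> f x \in L) ->
  entropy P f <= entropy P (g \o f) + ln C.
Proof.
move=> Mf C0 HC.
have sumgf : \sum_j P ((g \o f) @^-1` [set j]) = 1.
  by apply: sum_fa_preimage; exact: label_comp.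
rewrite /entropy [leLHS](partition_big g predT)//= -[ln C]mul1r -sumgf.
rewrite mulr_suml -big_split; apply: ler_sum => j _ /=.
have [_] := fa_preimage (fun i => g i == j) Mf.
rewrite (_ : _ @^-1` _ = (g \o f) @^-1` [set j]); last first.
  by apply/seteqP; split => x /= /eqP.
move=> ->.
(* Unattained labels have mass 0 and are dropped before counting, since the hypothesis counts only
   labels of actual points. *)
pose ne i := `[< exists x, f x = i >].
have ne0 i : ~~ ne i -> P (f @^-1` [set i]) = 0.
  move=> /asboolPn nei; rewrite (_ : f @^-1` [set i] = set0) ?fa_0//.
  by rewrite -subset0 => x fx; apply: nei; exists x.
rewrite (bigID ne)/= addrC big1 ?add0r; last first.
  by move=> i /andP[_ /ne0->]; rewrite eta0.
rewrite [in leRHS](bigID ne)/= [X in eta (_ + X)]big1; last first.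
  by move=> i /andP[_ /ne0->].
rewrite [X in (_ + X) * _]big1; last by move=> i /andP[_ /ne0->].
rewrite addr0; apply: sum_eta_le => //; first by move=> i; exact: (fa_ge0 PM).
have [[x0 gx0]|nx0] := pselect (exists x0, g (f x0) = j); last first.
  rewrite eq_card0 ?ltW// => i; apply/negbTE/negP.
  by move=> /andP[/eqP gij /asboolP[x fx]]; apply: nx0; exists x; rewrite fx.
have [L LC HL] := HC x0; apply: le_trans LC; rewrite ler_nat.
apply: leq_trans (card_size L); apply: subset_leq_card.
apply/fintype.subsetP => i /andP[/eqP gij /asboolP[x fx]].
by rewrite -fx; apply: HL; rewrite fx gij.
Qed.

Lemma entropy_le_count I J (f : T -> I) (g : T -> J) (C : R) :
  label M f -> label M g -> 0 < C ->
  (forall x0, exists2 L : seq I, (size L)%:R <= C &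
     forall x, g x = g x0 -> f x \in L) ->
  entropy P f <= entropy P g + ln C.
Proof.
move=> Mf Mg C0 HC; have Mfg := label_pair Mf Mg.
apply: le_trans (entropy_comp_le fst Mfg) _.
apply: (@entropy_comp_count _ _ _ snd _ Mfg C0) => x0.
have [L LC HL] := HC x0; exists [seq (i, g x0) | i <- L].
  by rewrite size_map.
by move=> x /= gx; rewrite gx; apply/mapP; exists (f x) => //; exact: HL.
Qed.

Lemma entropy_le_determined I J (f : T -> I) (g : T -> J) :
  label M f -> label M g -> (forall x y, g x = g y -> f x = f y) ->
  entropy P f <= entropy P g.
Proof.
move=> Mf Mg fg; rewrite -[leRHS]addr0 -(@ln1 R).
apply: entropy_le_count => // x0; exists [:: f x0] => // x gx.
by rewrite inE (fg _ _ gx).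
Qed.

(** Gibbs' inequality against the product of the marginals. The joint and the product weights both
    have total mass 1, so the linear terms cancel. *)
Lemma entropy_pair_le I J (f : T -> I) (g : T -> J) :
  label M f -> label M g ->
  entropy P (fun x => (f x, g x)) <= entropy P f + entropy P g.
Proof.
move=> Mf Mg; have Mfg := label_pair Mf Mg.
set p : I * J -> R := fun ij => P ((fun x => (f x, g x)) @^-1` [set ij]).
set p1 : I -> R := fun i => P (f @^-1` [set i]).
set p2 : J -> R := fun j => P (g @^-1` [set j]).
have p0 ij : 0 <= p ij by exact: (fa_ge0 PM).
have s1 i : \sum_j p (i, j) = p1 i.
  have [_] := fa_preimage (fun ij : I * J => ij.1 == i) Mfg.
  rewrite (_ : _ @^-1` _ = f @^-1` [set i]); last first.
    by apply/seteqP; split => x /= /eqP.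
  rewrite /p1 => ->; rewrite (reindex (fun j => (i, j)))/=; last first.
    exists snd => [//|[i' j]]; rewrite inE/= => /eqP ->//.
  by apply: eq_bigl => j; rewrite eqxx.
have s2 j : \sum_i p (i, j) = p2 j.
  have [_] := fa_preimage (fun ij : I * J => ij.2 == j) Mfg.
  rewrite (_ : _ @^-1` _ = g @^-1` [set j]); last first.
    by apply/seteqP; split => x /= /eqP.
  rewrite /p2 => ->; rewrite (reindex (fun i => (i, j)))/=; last first.
    exists fst => [//|[i j']]; rewrite inE/= => /eqP ->//.
  by apply: eq_bigl => i; rewrite eqxx.
have p12 i j : p (i, j) <= p1 i /\ p (i, j) <= p2 j.
  by rewrite -s1 -s2 (bigD1 j)//= [in X in _ /\ X](bigD1 i)//= !lerDl !sumr_ge0.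
have key i j : eta (p (i, j)) <=
    - (p (i, j) * ln (p1 i)) - p (i, j) * ln (p2 j) + (p1 i * p2 j - p (i, j)).
  have [h1 h2] := p12 i j; have := p0 (i, j).
  rewrite le_eqVlt => /predU1P[e|pp].
    by rewrite -e eta0 !mul0r !subr0 oppr0 add0r mulr_ge0// ?(le_trans (p0 (i, j))).
  have p1p : 0 < p1 i by exact: lt_le_trans h1.
  have p2p : 0 < p2 j by exact: lt_le_trans h2.
  apply: le_trans (eta_gibbs (p0 _) (mulr_gt0 p1p p2p)) _.
  by rewrite lnM ?posrE// mulrDr opprD.
have -> : entropy P (fun x => (f x, g x)) = \sum_i \sum_j eta (p (i, j)).
  by rewrite pair_bigA; apply: eq_bigr => -[].
apply: le_trans (ler_sum _ (fun i _ => ler_sum _ (fun j _ => key i j))) _.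
under eq_bigr do rewrite !big_split/=.
rewrite !big_split/=.
have -> : \sum_i \sum_j - (p (i, j) * ln (p1 i)) = \sum_i eta (p1 i).
  by apply: eq_bigr => i _; rewrite sumrN -mulr_suml s1.
have -> : \sum_i \sum_j - (p (i, j) * ln (p2 j)) = \sum_j eta (p2 j).
  by rewrite exchange_big/=; apply: eq_bigr => j _; rewrite sumrN -mulr_suml s2.
have -> : \sum_i \sum_j p1 i * p2 j = 1.
  under eq_bigr do rewrite -mulr_sumr.
  by rewrite -mulr_suml !sum_fa_preimage// mulr1.
have -> : \sum_i \sum_j - p (i, j) = -1.
  under eq_bigr do rewrite sumrN s1.
  by rewrite sumrN sum_fa_preimage.
by rewrite subrr addr0.
Qed.

Lemma entropy_ge0 I (f : T -> I) : label M f -> 0 <= entropy P f.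
Proof.
by move=> Mf; apply: sumr_ge0 => i _; rewrite eta_ge0 ?fa_le1// (fa_ge0 PM).
Qed.

Lemma entropy_le_ln_card I (f : T -> I) : label M f -> (0 < #|I|)%N ->
  entropy P f <= ln #|I|%:R.
Proof.
move=> Mf I0.
have Mt : label M (fun _ : T => tt).
  move=> []; rewrite (_ : _ @^-1` _ = setT); first exact: fa_measT PM.
  by apply/seteqP; split.
have := @entropy_le_count _ _ f (fun=> tt) #|I|%:R Mf Mt.
have -> : entropy P (fun _ : T => tt) = 0.
  rewrite /entropy (big_pred1 tt) => [|[]//].
  rewrite (_ : _ @^-1` _ = setT) ?(fa_total PM) /eta ?ln1 ?mulr0 ?oppr0//.
  by apply/seteqP; split.
rewrite add0r ltr0n; apply => // _; exists (enum I); first by rewrite -cardE.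
by move=> x _; rewrite mem_enum.
Qed.

Definition itinerary (S : T -> T) I (f : T -> I) (n : nat) (x : T) :
  {ffun 'I_n -> I} := [ffun k : 'I_n => f (iter k S x)].

Lemma itinerary_eqP (S : T -> T) I (f : T -> I) (n : nat) (x y : T) :
  itinerary S f n x = itinerary S f n y <->
  forall k, (k < n)%N -> f (iter k S x) = f (iter k S y).
Proof.
split => [/ffunP e k kn|e]; first by have := e (Ordinal kn); rewrite !ffunE.
by apply/ffunP => k; rewrite !ffunE e.
Qed.

Variable S : T -> T.
Hypothesis MS : forall A, M A -> M (S @^-1` A).
Hypothesis PS : forall A, M A -> P (S @^-1` A) = P A.

Lemma fa_meas_iter n A : M A -> M (iter n S @^-1` A).
Proof.
elim: n A => [//|n IH] A MA.
exact: IH _ (MS MA).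
Qed.

Lemma fa_iter n A : M A -> P (iter n S @^-1` A) = P A.
Proof.
by elim: n A => [//|n IH] A MA; rewrite -(PS MA) -(IH _ (MS MA)).
Qed.

Lemma label_iter I (f : T -> I) n : label M f -> label M (f \o iter n S).
Proof. by move=> Mf i; exact: (fa_meas_iter n (Mf i)). Qed.

Lemma entropy_iter I (f : T -> I) n : label M f ->
  entropy P (f \o iter n S) = entropy P f.
Proof. by move=> Mf; rewrite /entropy; apply: eq_bigr => i _; rewrite -(fa_iter n (Mf i)). Qed.

Lemma label_itinerary I (f : T -> I) n :
  label M f -> label M (itinerary S f n).
Proof.
move=> Mf w.
have -> : itinerary S f n @^-1` [set w] =
    \bigcap_(k in [set` index_enum 'I_n]) ((f \o iter k S) @^-1` [set w k]).
  apply/seteqP; split => x /=; first by move=> <- k _ /=; rewrite ffunE.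
  by move=> h; apply/ffunP => k; rewrite ffunE; apply: h; rewrite /= mem_index_enum.
rewrite bigcap_seq.
elim/big_ind: _ => [|A B MA MB|k _]; [exact: fa_measT PM|exact: (fa_measI PM)|].
exact: label_iter Mf _.
Qed.

Lemma entropy_itineraryD I (f : T -> I) m n : label M f ->
  entropy P (itinerary S f (m + n)) <=
  entropy P (itinerary S f m) + entropy P (itinerary S f n).
Proof.
move=> Mf; have Mm := @label_itinerary _ _ m Mf.
have Mn := @label_itinerary _ _ n Mf.
rewrite -(entropy_iter m Mn); have Mn' := label_iter m Mn.
apply: le_trans (entropy_pair_le Mm Mn').
apply: entropy_le_determined; [exact: label_itinerary|exact: label_pair|].
move=> x y [/itinerary_eqP e1 /itinerary_eqP e2]; apply/itinerary_eqP => k kmn.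
have [|mk] := ltnP k m; first exact: e1.
rewrite -(subnK mk) !iterD; apply: e2; lia.
Qed.

Lemma entropy_itinerary_le I (f : T -> I) n : label M f ->
  entropy P (itinerary S f n) <= n%:R * entropy P f.
Proof.
move=> Mf; elim: n => [|n IH].
  rewrite mul0r; apply: le_trans (entropy_le_ln_card (@label_itinerary _ _ 0 Mf) _) _.
    by rewrite card_ffun card_ord expn0.
  by rewrite card_ffun card_ord expn0 ln1.
rewrite -addn1 natrD mulrDl mul1r; apply: le_trans (entropy_itineraryD n 1 Mf) _.
rewrite lerD//; apply: entropy_le_determined => //; first exact: label_itinerary.
by move=> x y e; apply/itinerary_eqP; case.
Qed.

End FinitelyAdditiveEntropy.

(** * Entropy rates *)

Lemma fekete (R : realType) (u : nat -> R) :
  (forall n, 0 <= u n) -> (forall m n, u (m + n)%N <= u m + u n) ->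
  exists l : R, (fun n => n%:R^-1 * u n) @ \oo --> l /\
    forall n, (0 < n)%N -> n%:R * l <= u n.
Proof.
move=> u0 uD.
pose E := [set x | exists2 n, (0 < n)%N & x = n%:R^-1 * u n].
have E0 : has_inf E.
  split; first by exists (1%:R^-1 * u 1%N), 1%N.
  by exists 0 => _ [n _ ->]; rewrite mulr_ge0// invr_ge0.
pose l := inf E.
have lle n : (0 < n)%N -> l <= n%:R^-1 * u n.
  by move=> n0; apply: ge_inf; [case: E0|exists n].
have uM q k : u (q * k)%N <= q%:R * u k + u 0%N.
  elim: q => [|q IH]; first by rewrite mul0n mul0r add0r.
  rewrite mulSn -[q.+1]addn1 natrD mulrDl mul1r; apply: le_trans (uD _ _) _.
  lra.
exists l; split; last first.
  by move=> n n0; have := lle n n0; rewrite mulrC ler_pdivlMr ?ltr0n// mulrC.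
apply/cvgrPdist_lt => e e0.
have [_ [k k0 ->] kle] : exists2 x, E x & x < l + e / 2.
  by apply: inf_adherent => //; rewrite divr_gt0.
(* Error of the division of [n] by [k]: [u 0] from the multiple of [k], and [k * (u 1 + u 0) + u 0]
   from the remainder, which is below [k]. *)
pose C := u 0%N + k%:R * (u 1%N + u 0%N) + u 0%N.
have C0 : 0 <= C by rewrite !addr_ge0 ?mulr_ge0 ?addr_ge0.
near=> n.
have n0 : (0 < n)%N by near: n; exact: nbhs_infty_gt.
have nR : 0 < n%:R :> R by rewrite ltr0n.
have kR : 0 < k%:R :> R by rewrite ltr0n.
rewrite distrC ger0_norm ?subr_ge0 ?lle//.
suff h : u n <= n%:R * (k%:R^-1 * u k) + C.
  have : n%:R^-1 * u n <= k%:R^-1 * u k + C / n%:R.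
    rewrite mulrC ler_pdivrMr//; apply: le_trans h _.
    by rewrite mulrDl divfK ?gt_eqF// [n%:R * _]mulrC.
  have : C / n%:R < e / 2.
    rewrite ltr_pdivrMr// mulrC -ltr_pdivrMr ?divr_gt0//.
    by near: n; exact: nbhs_infty_gtr.
  lra.
rewrite {1}(divn_eq n k); apply: le_trans (uD _ _) _.
have h1 := uM (n %/ k)%N k.
have h2 : u (n %% k)%N <= k%:R * (u 1%N + u 0%N) + u 0%N.
  rewrite -[X in u X]muln1; apply: le_trans (uM _ _) _; rewrite lerD2r.
  apply: (@le_trans _ _ (k%:R * u 1%N)); last by rewrite ler_pM2l// lerDl.
  by rewrite ler_wpM2r// ler_nat ltnW// ltn_mod.
have h3 : (n %/ k)%:R * u k <= n%:R * (k%:R^-1 * u k).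
  rewrite mulrA ler_wpM2r// ler_pdivlMr// -natrM ler_nat; exact: leq_divM.
rewrite /C; lra.
Unshelve. all: by end_near. Qed.

Section EntropyRate.
Context {R : realType} {T : Type} (M : set T -> Prop) (P : set T -> R).
Hypothesis PM : finitely_additive M P.
Variable S : T -> T.
Hypothesis MS : forall A, M A -> M (S @^-1` A).
Hypothesis PS : forall A, M A -> P (S @^-1` A) = P A.

Definition rate (I : finType) (f : T -> I) : R :=
  limn (fun n => n%:R^-1 * entropy P (itinerary S f n)).

Lemma rate_spec (I : finType) (f : T -> I) : label M f ->
  (fun n => n%:R^-1 * entropy P (itinerary S f n)) @ \oo --> rate f /\
  forall n, (0 < n)%N -> n%:R * rate f <= entropy P (itinerary S f n).
Proof.
move=> Mf; have [] := @fekete _ (fun n => entropy P (itinerary S f n)).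
- by move=> n; apply: (entropy_ge0 PM); exact: (label_itinerary PM MS).
- by move=> m n; exact: (entropy_itineraryD PM MS PS).
by move=> l [cl lu]; rewrite /rate (cvg_lim _ cl).
Qed.

Lemma rate_ge (I : finType) (f : T -> I) (c : R) : label M f ->
  (forall n, (0 < n)%N -> n%:R * c <= entropy P (itinerary S f n)) ->
  c <= rate f.
Proof.
move=> Mf h; have [cf _] := rate_spec Mf.
have -> : rate f = limn (fun n => n%:R^-1 * entropy P (itinerary S f n)).
  by [].
apply: limr_ge; first by apply/cvg_ex; exists (rate f).
near=> n; have n0 : (0 < n)%N by near: n; exact: nbhs_infty_gt.
by rewrite [leRHS]mulrC ler_pdivlMr ?ltr0n// mulrC h.
Unshelve. all: by end_near. Qed.

Lemma rate_le (I J : finType) (f : T -> I) (g : T -> J) (b C : R) :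
  label M f -> label M g ->
  (forall n, (0 < n)%N -> entropy P (itinerary S f n) <=
     entropy P (itinerary S g n) + n%:R * b + C) ->
  rate f <= rate g + b.
Proof.
move=> Mf Mg h; have [cf _] := rate_spec Mf; have [cg _] := rate_spec Mg.
have h0 : (fun n : nat => C * n%:R^-1) @ \oo --> C * (0 : R).
  apply: cvgMr; apply/cvgrPdist_lt => e e0; near=> n.
  rewrite sub0r normrN ger0_norm ?invr_ge0// invf_plt ?posrE ?ltr0n//.
    by near: n; exact: nbhs_infty_gtr.
  by near: n; exact: nbhs_infty_gt.
have h1 : (fun n : nat => n%:R^-1 * entropy P (itinerary S g n) + b
   + C * n%:R^-1) @ \oo --> rate g + b + C * 0.
  by apply: cvgD => //; apply: cvgD => //; exact: cvg_cst.
rewrite mulr0 addr0 in h1.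
apply: ler_cvg_to cf h1 _; near=> n.
have n0 : (0 < n)%N by near: n; exact: nbhs_infty_gt.
have nR : 0 < n%:R :> R by rewrite ltr0n.
rewrite mulrC ler_pdivrMr//; apply: le_trans (h n n0) _.
rewrite !mulrDl mulrAC mulVf ?gt_eqF// mul1r divfK ?gt_eqF//.
by rewrite [b * _]mulrC.
Unshelve. all: by end_near. Qed.

Lemma rate_determined (I J : finType) (f : T -> I) (g : T -> J) :
  label M f -> label M g -> (forall x y, g x = g y -> f x = f y) ->
  rate f <= rate g.
Proof.
move=> Mf Mg fg; rewrite -[leRHS]addr0; apply: (@rate_le _ _ _ _ _ 0) => //.
move=> n n0; rewrite mulr0 !addr0.
apply: (entropy_le_determined PM); try exact: (label_itinerary PM MS).
by move=> x y /itinerary_eqP e; apply/itinerary_eqP => k kn; apply: fg; exact: e.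
Qed.

End EntropyRate.

(** * Kolmogorov-Sinai entropy through labels *)

Section KolmogorovSinaiRate.
Context {R : realType} {d : measure_display} {T : measurableType d}.
Variables (mu : probability T R) (S : T -> T).
Hypothesis mS : forall A : set T, measurable A -> measurable (S @^-1` A).
Hypothesis muS : invariant_measure mu S.

Definition realprob (A : set T) : R := fine (mu A).

Lemma realprobE A : measurable A -> mu A = (realprob A)%:E.
Proof. by move=> mA; rewrite /realprob fineK// fin_num_measure. Qed.

Lemma realprob_fa : finitely_additive measurable realprob.
Proof.
split.
- exact: measurableT.
- by move=> A; exact: measurableC.
- by move=> A B; exact: measurableI.
- by move=> A mA; rewrite /realprob fine_ge0.
- by rewrite /realprob probability_setT.
- move=> A B mA mB AB; rewrite /realprob measureU// fineD// fin_num_measure//.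
Qed.

Lemma realprobS A : measurable A -> realprob (S @^-1` A) = realprob A.
Proof. by move=> mA; rewrite /realprob muS. Qed.

Lemma partition_entropyE (I : finType) (f : T -> I) : label measurable f ->
  partition_entropy mu (fun i => f @^-1` [set i]) = (entropy realprob f)%:E.
Proof.
move=> Mf; rewrite /partition_entropy /entropy /eta sumrN EFinN -sumEFin.
congr oppe; apply: eq_bigr => i _; rewrite realprobE//.
have : 0 <= realprob (f @^-1` [set i]) by exact: (fa_ge0 realprob_fa).
rewrite le_eqVlt => /predU1P[<-|p0]; first by rewrite mul0e mul0r.
by rewrite lne_EFin// -EFinM.
Qed.

Lemma entropy_rateE (k : nat) (f : T -> 'I_k) : label measurable f ->
  entropy_rate mu S (fun i => f @^-1` [set i]) = (rate realprob S f)%:E.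
Proof.
move=> Mf; rewrite /entropy_rate.
have -> : (fun n : nat => (n%:R^-1)%:E *
    partition_entropy mu (iterated_join S (fun i => f @^-1` [set i]) (n:=n)))%E =
    (EFin \o (fun n : nat => n%:R^-1 * entropy realprob (itinerary S f n))).
  apply/funext => n /=; rewrite EFinM -partition_entropyE; last first.
    exact: (label_itinerary realprob_fa mS).
  congr (_ * partition_entropy mu _)%E; apply/funext => w.
  apply/seteqP; split => x /= h.
    by apply/ffunP => i; rewrite ffunE; exact: h.
  by move=> i _ /=; rewrite -h ffunE.
apply/cvg_lim => //; apply: cvg_EFin; first exact: nearW.
by have [] := rate_spec realprob_fa mS realprobS Mf.
Qed.

(** Admissible partitions have nonempty cells indexed by an ordinal, so [f] is renumbered by the
    positions of its attained values. *)
Lemma KS_entropy_ge (I : finType) (f : T -> I) : label measurable f ->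
  ((rate realprob S f)%:E <= KS_entropy mu S)%E.
Proof.
move=> Mf.
pose s := [seq i <- enum I | `[< exists x, f x = i >]].
have fs x : f x \in s.
  by rewrite mem_filter mem_enum andbT; apply/asboolP; exists x.
have us : uniq s by rewrite filter_uniq// enum_uniq.
pose g x : 'I_(size s) := Ordinal (etrans (index_mem _ _) (fs x)).
have gf x y : (g x = g y) <-> (f x = f y).
  split => [|e]; last by apply: val_inj; rewrite /= e.
  move=> /(congr1 val)/= e.
  by rewrite -(nth_index (f x) (fs x)) e nth_index.
have gE j : g @^-1` [set j] = f @^-1` [set tnth (in_tuple s) j].
  apply/seteqP; split => x /=.
    by move=> <-; rewrite (tnth_nth (f x))/= nth_index.
  move=> e; apply: val_inj => /=; rewrite e (tnth_nth (f x))/= index_uniq//.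
have Mg : label measurable g by move=> j; rewrite gE; exact: Mf.
apply: (@le_trans _ _ (rate realprob S g)%:E).
  rewrite lee_fin; apply: (rate_determined realprob_fa) => //.
    exact: realprobS.
  by move=> x y /gf.
rewrite -entropy_rateE//; apply: ereal_sup_ubound.
exists (size s), (fun i => g @^-1` [set i]); split => //; split => //.
split.
- by apply/seteqP; split => // x _; exists (g x).
- by move=> i j _ _ [x [/= <- <-]].
- move=> j _; have : tnth (in_tuple s) j \in s by exact: mem_tnth.
  rewrite mem_filter => /andP[/asboolP[x fx] _]; exists x.
  by rewrite gE /= fx.
Qed.

Lemma KS_entropy_le (c : \bar R) :
  (forall k (f : T -> 'I_k), label measurable f ->
     ((rate realprob S f)%:E <= c)%E) ->
  (KS_entropy mu S <= c)%E.
Proof.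
move=> h; apply: ge_ereal_sup => _ [k [A [[[covA trivA _] mA] ->]]].
have ex x : exists i, A i x.
  have : [set: T] x by [].
  by rewrite -covA => -[i _ Aix]; exists i.
pose f x := sval (cid (ex x)).
have AE : A = (fun i => f @^-1` [set i]).
  apply/funext => i; apply/seteqP; split => x /=; rewrite /f; case: cid => j/= Aj.
    by move=> Ai; apply: (trivA j i) => //; exists x.
  by move=> <-.
have Mf : label measurable f by move=> i; move: (mA i); rewrite AE.
by rewrite AE entropy_rateE//; exact: h.
Qed.

End KolmogorovSinaiRate.

(** * Borel measures on metrizable spaces *)

Section CompatibleDistance.
Context {R : realType} {Z : topologicalType}.
Variable d : Z -> Z -> R.
Hypothesis dZ : compatible_distance d.

Lemma dist_ge0 x y : 0 <= d x y. Proof. by case: dZ => -[]. Qed.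
Lemma dist_eq0 x y : d x y = 0 <-> x = y. Proof. by case: dZ => -[]. Qed.
Lemma distxx x : d x x = 0. Proof. exact/dist_eq0. Qed.
Lemma dist_sym x y : d x y = d y x. Proof. by case: dZ => -[]. Qed.
Lemma dist_triangle x y z : d x z <= d x y + d y z.
Proof. by case: dZ => -[]. Qed.
Lemma dist_nbhs (x : Z) (A : set Z) :
  nbhs x A <-> exists2 e : R, 0 < e & [set y | d x y < e] `<=` A.
Proof. by case: dZ. Qed.

Lemma nbhs_dball x e : 0 < e -> nbhs x [set y | d x y < e].
Proof. by move=> e0; apply/dist_nbhs; exists e. Qed.

Lemma open_dball x e : open [set y | d x y < e].
Proof.
rewrite openE => y /= xy; apply/dist_nbhs; exists (e - d x y).
  by rewrite subr_gt0.
by move=> z /= yz; have := dist_triangle x y z; lra.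
Qed.

Lemma closed_dball x e : closed [set y | d x y <= e].
Proof.
rewrite -[X in closed X]setCK; apply: open_closedC; rewrite openE => y /=.
move=> /negP; rewrite -ltNge => xy; apply/dist_nbhs; exists (d x y - e).
  by rewrite subr_gt0.
move=> z /= yz; apply/negP; rewrite -ltNge.
by have := dist_triangle x z y; rewrite (dist_sym z y); lra.
Qed.

Lemma dist_hausdorff : hausdorff_space Z.
Proof.
move=> p q pq; apply/dist_eq0/eqP; rewrite eq_le dist_ge0 andbT leNgt.
apply/negP => d0; have d2 : 0 < d p q / 2 by rewrite divr_gt0.
have [z [/= pz qz]] := pq _ _ (nbhs_dball p d2) (nbhs_dball q d2).
by have := dist_triangle p z q; rewrite (dist_sym z q); lra.
Qed.

(** Compactness makes the radius uniform; half of each local radius is kept for moving the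
    centre. *)
Lemma compact_uniform_dball (K U : set Z) : compact K -> open U -> K `<=` U ->
  exists2 e : R, 0 < e & forall x y, K x -> d x y < e -> U y.
Proof.
move=> /compact_near_coveringP cK oU KU.
have : \forall e \near (0 : R)^'+, K `<=` (fun x => forall y, d x y < e -> U y).
  apply: cK => x Kx.
  have [r r0 xr] : exists2 r, 0 < r & [set y | d x y < r] `<=` U.
    by apply/dist_nbhs; apply: open_nbhs_nbhs; split => //; exact: KU.
  have r2 : 0 < r / 2 by rewrite divr_gt0.
  exists ([set y | d x y < r / 2], [set e | e < r / 2]).
    by split => /=; [exact: nbhs_dball|exact: nbhs_right_lt].
  move=> [x' e] [/= xx' er] y x'y; apply: xr => /=.
  by have := dist_triangle x x' y; lra.
move=> h; near (0 : R)^'+ => e; exists e; first by [].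
by move=> x y Kx; apply: (near h e _ x Kx y).
Unshelve. all: by end_near. Qed.

End CompatibleDistance.

Lemma probability_bigcap0 (R : realType) (dT : measure_display)
    (T : measurableType dT) (mu : probability T R) (F : (set T)^nat) (e : R) :
  0 < e -> (forall n, measurable (F n)) ->
  (forall m n, (m <= n)%N -> F n `<=` F m) -> \bigcap_n F n = set0 ->
  exists N, (mu (F N) < e%:E)%E.
Proof.
move=> e0 mF dF F0.
have : (mu \o F) @ \oo --> mu (\bigcap_n F n).
  apply: nonincreasing_cvg_mu => //.
  - by apply: le_lt_trans (probability_le1 _ _) (ltry _).
  - by rewrite F0.
  - by move=> m n mn; apply/subsetPset; exact: dF.
rewrite F0 measure0 => /fine_cvgP[_ /cvgrPdist_lt/(_ _ e0) h].
near \oo => N; exists N.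
have : `|0 - fine (mu (F N))| < e by near: N.
rewrite sub0r normrN ger0_norm ?fine_ge0// => hN.
by rewrite -[mu _]fineK ?fin_num_measure ?lte_fin.
Unshelve. all: by end_near. Qed.

Section BorelMeasure.
Context {R : realType} {Z : topologicalType} {z0 : Z}.
Variable d : Z -> Z -> R.
Hypothesis dZ : compatible_distance d.
Variable mu : probability (borelType z0) R.

Lemma open_borel (U : set (borelType z0)) : @open Z U -> measurable U.
Proof. exact: sub_sigma_algebra. Qed.

Lemma closed_borel (F : set (borelType z0)) : @closed Z F -> measurable F.
Proof.
move=> cF; rewrite -[F]setCK; apply: measurableC; apply: open_borel.
exact: closed_openC.
Qed.

Let regular (B : set Z) := forall e : R, 0 < e ->
  exists F G : set (borelType z0), [/\ @closed Z F, @open Z G, F `<=` B,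
    B `<=` G & (mu (G `\` F) < e%:E)%E].

Let regular_open (U : set Z) : open U -> regular U.
Proof.
move=> oU e e0.
(* Points at distance at least 1 / (n + 1) from the complement of [U]: closed sets increasing to
   [U]. *)
pose F (n : nat) : set Z :=
  [set x | forall y, d x y < n.+1%:R^-1 -> U y].
have FU n : F n `<=` U by move=> x; apply; rewrite (distxx dZ) invr_gt0.
have cF n : @closed Z (F n).
  rewrite -[X in closed X]setCK; apply: open_closedC; rewrite openE => x /=.
  move=> /existsNP[y /not_implyP[xy Uy]]; apply/(dist_nbhs dZ).
  exists (n.+1%:R^-1 - d x y); first by rewrite subr_gt0.
  move=> z /= xz Fz; apply/Uy/Fz.
  apply: le_lt_trans (dist_triangle dZ z x y) _.
  by rewrite (dist_sym dZ z x) -ltrBrDr.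
have UF : \bigcup_n F n = U.
  apply/seteqP; split => [x [n _ /FU]//|x Ux].
  have [r r0 xr] : exists2 r, 0 < r & [set y | d x y < r] `<=` U.
    by apply/(dist_nbhs dZ); apply: open_nbhs_nbhs; split.
  near \oo => n; exists n => // y xy; apply: xr => /=; apply: lt_trans xy _.
  rewrite invf_plt ?posrE//; apply: (@lt_trans _ _ n%:R); last by rewrite ltr_nat.
  by near: n; exact: nbhs_infty_gtr.
have mF n : measurable (F n : set (borelType z0)) by exact: closed_borel.
have mU : measurable (U : set (borelType z0)) by exact: open_borel.
have [|||N UFN] := @probability_bigcap0 _ _ _ mu
  (fun n => (U : set (borelType z0)) `\` F n) e e0.
- by move=> n; exact: measurableD.
- move=> m n mn x [Ux Fn]; split => // Fm; apply: Fn => y xy.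
  by apply: Fm; apply: lt_le_trans xy _; rewrite lef_pV2 ?posrE// ler_nat.
- rewrite -subset0 => x /= h; have [Ux _] := h 0%N I.
  by move: Ux; rewrite -UF => -[n _ Fn]; have [_] := h n I.
exists (F N), U; split => //; exact: FU.
Unshelve. all: by end_near. Qed.

Let regularC (B : set Z) : regular B -> regular (~` B).
Proof.
move=> rB e e0; have [F [G [cF oG FB BG FG]]] := rB e e0.
exists (~` G), (~` F); split.
- exact: open_closedC.
- exact: closed_openC.
- by apply: subsetC.
- by apply: subsetC.
- by rewrite setDE setCK setIC -setDE.
Qed.

Let regular_bigcup (B : (set Z)^nat) :
  (forall n, regular (B n)) -> regular (\bigcup_n B n).
Proof.
move=> rB e e0.
(* One half of [e] is shared geometrically among the [B n]; the other pays for truncating the union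
   of the [F n] to a finite one, which is closed. *)
have e20 : 0 < e / 2 by rewrite divr_gt0.
have en n : 0 < e / 2 / (2 ^ n.+1)%:R by rewrite divr_gt0// ltr0n expn_gt0.
have [F hF] := choice (fun n => rB n _ (en n)).
have [G hG] := choice hF.
have cF n : @closed Z (F n) by case: (hG n).
have oG n : @open Z (G n) by case: (hG n).
have FB n : F n `<=` B n by case: (hG n).
have BG n : B n `<=` G n by case: (hG n).
have FG n : (mu (G n `\` F n) < (e / 2 / (2 ^ n.+1)%:R)%:E)%E by case: (hG n).
have mF n : measurable (F n) by exact: closed_borel.
have mG n : measurable (G n) by exact: open_borel.
have mFG n : measurable (G n `\` F n) by exact: measurableD.
pose V := \bigcup_n F n.
have mV : measurable V by exact: bigcup_measurable.
have mFN N : measurable (\big[setU/set0]_(i < N) F i) by exact: bigsetU_measurable.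
have [|||N VN] := @probability_bigcap0 _ _ _ mu
  (fun n => V `\` \big[setU/set0]_(i < n) F i) _ e20.
- by move=> n; exact: measurableD.
- move=> m n mn; apply: setDS.
  rewrite -!bigcup_mkord => x [i /= im Fi]; exists i => //=.
  exact: leq_trans mn.
- rewrite -subset0 => x /= h; have [[n _ Fnx] _] := h 0%N I.
  by have [_] := h n.+1 I; rewrite -bigcup_mkord; apply; exists n => /=.
exists (\big[setU/set0]_(i < N) F i), (\bigcup_n G n); split.
- by apply: closed_bigsetU => i _; exact: cF.
- by apply: bigcup_open => i _; exact: oG.
- by rewrite -bigcup_mkord => x [i _ /FB Bi]; exists i.
- by move=> x [i _ /BG Gi]; exists i.
have sub : \bigcup_n G n `\` \big[setU/set0]_(i < N) F i `<=`
    (\bigcup_n (G n `\` F n)) `|` (V `\` \big[setU/set0]_(i < N) F i).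
  move=> x [[i _ Gi] NF]; have [Fi|nFi] := pselect (F i x).
    by right; split => //; exists i.
  by left; exists i.
have mGF : measurable (\bigcup_n (G n `\` F n)) by exact: bigcup_measurable.
have mVN : measurable (V `\` \big[setU/set0]_(i < N) F i) by exact: measurableD.
apply: (@le_lt_trans _ _ (mu ((\bigcup_n (G n `\` F n)) `|`
    (V `\` \big[setU/set0]_(i < N) F i)))).
  apply: le_measure => //; rewrite inE; last exact: measurableU.
  by apply: measurableD => //; exact: bigcup_measurable.
apply: le_lt_trans (measureU2 _ _ _) _ => //.
rewrite (splitr e) EFinD; apply: lee_ltD.
- by rewrite fin_num_measure.
- apply: (@le_trans _ _ (\sum_(n <oo) mu (G n `\` F n))%E).
    by apply: measure_sigma_subadditive => //; exact: subset_refl.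
  apply: (@le_trans _ _ (\sum_(n <oo) (0 + (e / 2 / (2 ^ n.+1)%:R)%:E))%E).
    by apply: lee_nneseries => // n _; rewrite add0e ltW.
  apply: le_trans (epsilon_trick _ _ _) _ => //; first exact: ltW.
  by rewrite eseries0// add0e.
- exact: VN.
Qed.

(** The sets that can be so approximated form a sigma-algebra containing the open sets. *)
Lemma borel_regular (B : set (borelType z0)) (e : R) : measurable B -> 0 < e ->
  exists F G : set (borelType z0), [/\ @closed Z F, @open Z G, F `<=` B,
    B `<=` G & (mu (G `\` F) < e%:E)%E].
Proof.
move=> mB; move: e; rewrite -/(regular B).
have : smallest (sigma_algebra setT) (@open Z) B by exact: mB.
apply: smallest_sub; last by move=> U; exact: regular_open.
split.
- by apply: regular_open; exact: open0.
- by move=> A rA; rewrite setTD; exact: regularC.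
- by move=> A rA; exact: regular_bigcup.
Qed.

End BorelMeasure.

Lemma compact_finite_cover (T : topologicalType) (I : choiceType) (A : set T)
    (f : I -> set T) : compact A -> (forall i, open (f i)) ->
  (forall x, A x -> exists i, f i x) ->
  exists s : seq I, forall x, A x -> exists2 i, i \in s & f i x.
Proof.
move=> /compact_near_coveringP cA of_ cov.
(* The filter generated by the families containing a given finite one; near-covering for it yields
   one finite family that works at all points of [A]. *)
pose F : set_system (seq I) :=
  filter_from setT (fun s0 : seq I => [set s : seq I | {subset s0 <= s}]).
have FF : Filter F.
  apply: filter_from_filter; first by exists [::].
  move=> s1 s2 _ _; exists (s1 ++ s2) => // s /= h; split => i si; apply: h.
    by rewrite mem_cat si.
  by rewrite mem_cat si orbT.
have [|s0 _ hs0] :=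
    cA _ F (fun (s : seq I) x => exists2 i, i \in s & f i x) FF.
  move=> x Ax; have [i fi] := cov x Ax.
  exists (f i, [set s : seq I | i \in s]) => [|[y s] [/= fy si]]; last by exists i.
  split => /=; first by apply: open_nbhs_nbhs; split.
  by exists [:: i] => // s /= h; apply: h; rewrite inE.
by exists s0 => x Ax; exact: (hs0 s0).
Qed.

(** * Tightness and inner regularity by compact sets *)

Section Tightness.
Context {R : realType} {Z : topologicalType} {z0 : Z}.
Variable mu : probability (borelType z0) R.
Hypothesis sZ : sep_lc_metrizable R Z.

Lemma locally_compact_nbhs (x : Z) : exists2 U : set Z, nbhs x U & compact U.
Proof.
case: sZ => _ lc _; have [U] := lc x I; rewrite withinET => Ux [cU _].
by exists U.
Qed.

(** [Z] is sigma-compact: those closed balls of radius 1 / (n + 1) around a countable dense set that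
    are compact already cover [Z]. Codes of non-compact balls, or of no ball, are sent to the empty
    set. *)
Lemma probability_tight (e : R) : 0 < e ->
  exists2 K : set (borelType z0), @compact Z K & (mu (~` K) < e%:E)%E.
Proof.
move=> e0; case: sZ => -[D cD dD] _ [d dZ].
have [f fD] : exists f : nat -> Z, forall x, D x -> exists i, f i = x.
  move/pfcard_geP : cD => [D0|/surjfunPex[f ->]].
    have [x []] := dD setT (ex_intro _ z0 I) openT.
    by rewrite D0.
  by exists f => _ [i _ <-]; exists i.
pose B (p : nat * nat) : set Z := [set y | d (f p.1) y <= p.2.+1%:R^-1].
pose C (k : nat) : set Z :=
  if unpickle k is Some p then if `[< compact (B p) >] then B p else set0
  else set0.
have cC k : compact (C k).
  rewrite /C; case: unpickle => [p|]; last exact: compact0.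
  by case: asboolP => // _; exact: compact0.
have clC k : closed (C k).
  by apply: compact_closed (cC k); exact: dist_hausdorff dZ.
have mC k : measurable (C k : set (borelType z0)) by exact: closed_borel.
have coverC x : exists k, C k x.
  have [U Ux cU] := locally_compact_nbhs x.
  have [r r0 xr] : exists2 r, 0 < r & [set y | d x y < r] `<=` U.
    exact/(dist_nbhs dZ).
  have [n hn] : exists n : nat, n.+1%:R^-1 < r / 2.
    near \oo => n; exists n; rewrite invf_plt ?posrE ?divr_gt0//.
    apply: (@lt_trans _ _ n%:R); last by rewrite ltr_nat.
    by near: n; exact: nbhs_infty_gtr.
  have n0 : 0 < n.+1%:R^-1 :> R by rewrite invr_gt0.
  have [q [/= xq Dq]] := dD _ (ex_intro _ x (nbhs_singleton (nbhs_dball dZ x n0)))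
    (open_dball dZ x _).
  have [i fi] := fD q Dq.
  exists (pickle (i, n)); rewrite /C pickleK.
  case: asboolP => [_|[]]; first by rewrite /B/= fi (dist_sym dZ) ltW.
  apply: (subclosed_compact _ cU); first exact: closed_dball.
  move=> y; rewrite /B/= fi => qy; apply: xr => /=.
  have := dist_triangle dZ x q y; move: xq qy hn.
  move: (n.+1%:R^-1) => s *; lra.
have [|||N hN] := @probability_bigcap0 _ _ _ mu
  (fun n => ~` \big[setU/set0]_(k < n) (C k : set (borelType z0))) _ e0.
- by move=> n; apply: measurableC; exact: bigsetU_measurable.
- move=> m n mn; apply: subsetC.
  rewrite -!bigcup_mkord => x [i /= im Fi]; exists i => //=.
  exact: leq_trans mn.
- rewrite -subset0 => x /= h; have [k Ck] := coverC x.
  have := h k.+1 I; rewrite -bigcup_mkord => h'; apply: h'.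
  by exists k => /=.
exists (\big[setU/set0]_(k < N) C k) => //.
by apply: bigsetU_compact => k _.
Unshelve. all: by end_near. Qed.

Lemma compact_inner_regular (B : set (borelType z0)) (e : R) :
  measurable B -> 0 < e ->
  exists K : set (borelType z0),
    [/\ @compact Z K, K `<=` B & (mu (B `\` K) < e%:E)%E].
Proof.
move=> mB e0; case: (sZ) => _ _ [d dZ].
have e20 : 0 < e / 2 by rewrite divr_gt0.
have [F [G [cF oG FB BG FG]]] := borel_regular dZ mu mB e20.
have [K cK hK] := probability_tight e20.
have mF : measurable F by exact: closed_borel.
have mG : measurable G by exact: open_borel.
have mK : measurable K.
  by apply: closed_borel; apply: compact_closed cK; exact: dist_hausdorff dZ.
exists (K `&` F); split; first exact: compact_closedI.
  by move=> x [_ /FB].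
have sub : B `\` (K `&` F) `<=` (~` K) `|` (G `\` F).
  move=> x [Bx KF]; have [Kx|] := pselect (K x); last by left.
  by right; split; [exact: BG|move=> Fx; apply: KF].
apply: (@le_lt_trans _ _ (mu ((~` K) `|` (G `\` F)))).
  apply: le_measure => //; rewrite inE.
    by apply: measurableD => //; exact: measurableI.
  by apply: measurableU; [exact: measurableC|exact: measurableD].
apply: le_lt_trans (measureU2 _ _ _) _; [exact: measurableC|exact: measurableD|].
by rewrite (splitr e) EFinD; exact: lteD.
Qed.

End Tightness.

Lemma continuous_borel (Z W : topologicalType) (z0 : Z) (w0 : W) (f : Z -> W) :
  continuous f -> forall B : set (borelType w0),
  measurable B -> measurable (f @^-1` B : set (borelType z0)).
Proof.
move=> cf B mB; have : smallest (sigma_algebra setT) (@open W) B by exact: mB.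
apply: (@smallest_sub _ _ _
    (fun B : set W => measurable (f @^-1` B : set (borelType z0)))).
  split.
  - by rewrite preimage_set0; exact: measurable0.
  - by move=> A mA; rewrite setTD preimage_setC; exact: measurableC.
  - by move=> A mA; rewrite preimage_bigcup; exact: bigcup_measurable.
by move=> U oU; apply: open_borel; apply: open_comp => // x _; exact: cf.
Qed.

(** Over a compact neighbourhood [L] of [y], the part of the preimage outside [O] is compact, so its
    image is closed; that image misses [y] and is removed from the interior of [L]. *)
Lemma proper_closed_nbhs (X Y : topologicalType) (f : X -> Y) (y : Y)
    (O : set X) :
  hausdorff_space Y -> (exists2 L : set Y, nbhs y L & compact L) ->
  continuous f -> proper_map f -> open O -> f @^-1` [set y] `<=` O ->
  exists W : set Y, [/\ open W, W y & f @^-1` W `<=` O].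
Proof.
move=> hY [L Ly cL] cf pf oO yO.
have cQ : compact (f @^-1` L `&` ~` O).
  by apply: compact_closedI; [exact: pf|exact: open_closedC].
have cfQ : compact (f @` (f @^-1` L `&` ~` O)).
  by apply: continuous_compact cQ; exact: continuous_subspaceT.
exists (L^° `&` ~` (f @` (f @^-1` L `&` ~` O))); split.
- apply: openI; first exact: open_interior.
  by apply: closed_openC; exact: compact_closed.
- split => // -[x [_ nO] fx]; exact/nO/yO.
- move=> x [/= /interior_subset Lfx nQ].
  by apply: contrapT => nO; apply: nQ; exists x.
Qed.

(** * Counting itineraries *)

(** Turns a finite family of sets into a partition. It is applied to open sets of [Y] and to balls
    of [T]. *)
Lemma label_membership (R : realType) (T : Type) (M : set T -> Prop)
    (P : set T -> R) (s : nat) (W : 'I_s -> set T) :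
  finitely_additive M P -> (forall i, M (W i)) ->
  label M (fun x => [ffun i : 'I_s => `[< W i x >]]).
Proof.
move=> PM MW w.
have -> : (fun x => [ffun i : 'I_s => `[< W i x >]]) @^-1` [set w] =
    \bigcap_(i in [set` index_enum 'I_s]) (if w i then W i else ~` W i).
  apply/seteqP; split => x /=.
    move=> <- i _; rewrite ffunE.
    by case: asboolP.
  move=> h; apply/ffunP => i; rewrite ffunE.
  have := h i (mem_index_enum i); case: (w i) => Wi; last exact/asboolPn.
  exact/asboolP.
rewrite bigcap_seq; elim/big_ind: _ => [|A B MA MB|i _].
- exact: fa_measT PM.
- exact: (fa_measI PM).
- by case: (w i) => //; exact: (fa_measC PM).
Qed.

Section CountingNames.
Context {R : realType} {T : Type} {I J : eqType}.
Variables (S : T -> T) (a : T -> I) (g : T -> J) (b : R) (M : nat).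
Hypothesis b0 : 0 <= b.

(** Itineraries as sequences, which can be concatenated without a change of type;
    [count_itineraries] translates back. *)
Definition name (L : eqType) (f : T -> L) (n : nat) (x : T) : seq L :=
  map f (traject S x n).

Lemma nameD (L : eqType) (f : T -> L) m n x :
  name f (m + n) x = name f m x ++ name f n (iter m S x).
Proof. by rewrite /name trajectD map_cat. Qed.

Lemma size_name (L : eqType) (f : T -> L) n x : size (name f n x) = n.
Proof. by rewrite size_map size_traject. Qed.

Lemma nth_name (L : eqType) (f : T -> L) l0 n x i : (i < n)%N ->
  nth l0 (name f n x) i = f (iter i S x).
Proof. by move=> im; rewrite (nth_map x) ?size_traject// nth_traject. Qed.

Lemma name_eqP (L : eqType) (f : T -> L) n x y :
  name f n x = name f n y <->
  forall i, (i < n)%N -> f (iter i S x) = f (iter i S y).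
Proof.
split => [e i im|e]; first by rewrite -(nth_name f (f x) x im) e nth_name.
apply: (@eq_from_nth _ (f x)) => [|i]; rewrite !size_name// => im.
by rewrite !nth_name// e.
Qed.

(** The orbit of [x0] is cut into blocks, each of the length [n1] given at its starting point, and
    the factors [expR (b * n1)] multiply. The last block may be truncated at time [n] but is charged
    in full: hence the hypothesis for all [m <= n1], and the excess [M] in the exponent. *)
Lemma count_names :
  (forall x0, exists n1, [/\ (0 < n1)%N, (n1 <= M)%N & forall m,
     (0 < m)%N -> (m <= n1)%N -> exists2 L : seq (seq I),
     (size L)%:R <= expR (b * n1%:R) &
     forall x, name g m x = name g m x0 -> name a m x \in L]) ->
  forall n x0, exists2 L : seq (seq I),
     (size L)%:R <= expR (b * (n + M)%:R) &
     forall x, name g n x = name g n x0 -> name a n x \in L.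
Proof.
move=> H; elim/ltn_ind => n IH x0.
have [n1 [n10 n1M Hm]] := H x0.
have [->|n0] := posnP n.
  exists [:: [::]]; last by move=> x _; rewrite /name/= inE.
  by rewrite -(@expR0 R) ler_expR mulr_ge0.
have [nn1|n1n] := leqP n n1.
  have [L LC HL] := Hm n n0 nn1; exists L => //; apply: le_trans LC _.
  by rewrite ler_expR ler_wpM2l// ler_nat (leq_trans n1M)// leq_addl.
have [L1 L1C HL1] := Hm n1 n10 (leqnn _).
have [|L2 L2C HL2] := IH (n - n1)%N _ (iter n1 S x0); first lia.
exists [seq p ++ q | p <- L1, q <- L2].
  rewrite size_allpairs natrM.
  apply: (@le_trans _ _ (expR (b * n1%:R) * expR (b * (n - n1 + M)%:R))).
    by rewrite ler_pM.
  by rewrite -expRD -mulrDr -natrD addnA subnKC// ltnW.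
move=> x; rewrite -(subnKC (ltnW n1n)) !nameD => /eqP.
rewrite eqseq_cat ?size_name// => /andP[/eqP e1 /eqP e2].
by apply: allpairs_f; [exact: HL1|exact: HL2].
Qed.

End CountingNames.

Lemma count_itineraries (R : realType) (T : Type) (S : T -> T)
    (I J : finType) (a : T -> I) (g : T -> J) (C : R) (n : nat) (x0 : T) :
  (exists2 L : seq (seq I), (size L)%:R <= C &
     forall x, name S g n x = name S g n x0 -> name S a n x \in L) ->
  exists2 L : seq {ffun 'I_n -> I}, (size L)%:R <= C &
    forall x, itinerary S g n x = itinerary S g n x0 ->
      itinerary S a n x \in L.
Proof.
move=> [L LC HL].
exists [seq [ffun i : 'I_n => nth (a x0) s i] | s <- L]; rewrite ?size_map//.
move=> x /itinerary_eqP e; apply/mapP; exists (name S a n x).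
  by apply: HL; apply/name_eqP.
by apply/ffunP => i; rewrite !ffunE nth_name.
Qed.

(** * Pushforward of Borel probabilities *)

Section MakeProbability.
Context {R : realType} {d : measure_display} {T : measurableType d}.
Variable m : set T -> \bar R.
Hypotheses (m0 : m set0 = 0%E) (m_ge0 : forall A, (0 <= m A)%E)
  (m_sigma : semi_sigma_additive m) (m1 : m setT = 1%E).

Definition probability_set_function := m.

Local Notation mp := probability_set_function.

HB.instance Definition _ := isMeasure.Build _ _ _ mp m0 m_ge0 m_sigma.
HB.instance Definition _ := Measure_isProbability.Build _ _ _ mp m1.

Lemma probability_exists : exists mu : probability T R, forall A, mu A = m A.
Proof. by exists mp. Qed.

End MakeProbability.

Lemma pushforward_probability_exists (R : realType) (X Y : topologicalType)
    (x0 : X) (f : X -> Y) (mu : probability (borelType x0) R) :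
  continuous f ->
  exists nu : probability (borelType (f x0)) R,
    forall A, nu A = mu (f @^-1` A).
Proof.
move=> cf; pose m (A : set (borelType (f x0))) := mu (f @^-1` A).
have mm (A : set (borelType (f x0))) : measurable A ->
    measurable (f @^-1` A : set (borelType x0)) by exact: continuous_borel.
have ms : semi_sigma_additive m.
  move=> F mF tF mUF; rewrite /m preimage_bigcup.
  apply: measure_semi_sigma_additive.
  - by move=> n; exact: mm.
  - by move=> i j _ _ [x [/= Fi Fj]]; apply: tF => //; exists (f x).
  - by rewrite -preimage_bigcup; exact: mm.
apply: (@probability_exists _ _ _ m) => //.
by rewrite /m preimage_setT probability_setT.
Qed.

(* On a safe set, whether an orbit lies in the compacts [K i] at the first [n]
   times decides in which of them it lies. *)
Definition safe (X : Type) (I : eqType) (phi : X -> X) (K : I -> set X) (n : nat)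
    (U : set X) :=
  forall m i j x y, (m < n)%N -> U x -> U y ->
    K i (iter m phi x) -> K j (iter m phi y) -> i = j.

(** The common interface of the two claims of the theorem: obtained from Bowen spanning sets in one
    and from Bowen balls of [tau] in the other. One time [n] is enough. *)
Definition safe_covers (R : realType) (X : Type) (I : eqType) (phi : X -> X)
    (K : I -> set X) (b : R) (Q : set X) :=
  exists n N (U : 'I_N -> set X), [/\ (0 < n)%N, N%:R <= expR (b * n%:R),
    forall l, safe phi K n (U l) & Q `<=` \bigcup_l U l].

Lemma continuous_iter (X : topologicalType) (f : X -> X) (n : nat) :
  continuous f -> continuous (iter n f).
Proof.
move=> cf; elim: n => [|n IH] x; first exact: cvg_id.
by apply: continuous_comp; [exact: IH|exact: cf].
Qed.

Lemma safe_thickening (X : topologicalType) (I : finType) (phi : X -> X)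
    (K : I -> set X) (n : nat) (U : set X) :
  continuous phi -> (forall i, closed (K i)) -> safe phi K n U ->
  exists O : set X, [/\ open O, U `<=` O & safe phi K n O].
Proof.
move=> cphi cK sU.
pose F (p : 'I_n * I) := iter p.1 phi @^-1` K p.2.
pose bad (p : 'I_n * I) := `[< U `&` F p = set0 >].
exists (~` \bigcup_(p in [set` [seq p <- enum {: 'I_n * I} | bad p]]) F p); split.
- rewrite bigcup_seq; apply: closed_openC.
  apply: closed_bigsetU => p _; apply: closed_comp => [x _|]; last exact: cK.
  exact: continuous_iter.
- move=> x Ux [p]; rewrite /= mem_filter => /andP[/asboolP UF _] Fp.
  by have : (U `&` F p) x by []; rewrite UF.
- move=> m i j x y mn Ox Oy Ki Kj.
  have ex l z : (~` \bigcup_(p in [set` [seq p <- enum {: 'I_n * I} | bad p]]) F p) z ->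
      K l (iter m phi z) -> exists2 u, U u & K l (iter m phi u).
    move=> Oz Kl; apply: contrapT => h; apply: Oz; exists (Ordinal mn, l) => //=.
    rewrite mem_filter mem_enum andbT; apply/asboolP; rewrite -subset0.
    by move=> u [Uu Fu]; apply: h; exists u.
  have [u Uu Ku] := ex _ _ Ox Ki; have [v Uv Kv] := ex _ _ Oy Kj.
  exact: (sU m i j u v).
Qed.

(** * The entropy bound from covers of the fibres *)

(** By Gibbs at 1, [None] contributes at most the mass outside it. So the other cells need only
    total [e / 2] in mass and [e / 2] in entropy. The threshold precedes the measure and the label
    because the compacts will be chosen from it. *)
Lemma entropy_option_small (R : realType) (I : finType) (e : R) : 0 < e ->
  exists2 dlt : R, 0 < dlt &
    forall (T : Type) (M : set T -> Prop) (P : set T -> R) (f : T -> option I),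
    finitely_additive M P -> label M f ->
    (forall i, P (f @^-1` [set Some i]) < dlt) -> entropy P f <= e.
Proof.
move=> e0; pose N := #|{: option I}|.
have N0 : 0 < N%:R :> R by rewrite ltr0n; apply/card_gt0P; exists None.
have e'0 : 0 < e / (2 * N%:R) by rewrite divr_gt0// mulr_gt0.
have [t t0 ht] := continuous_eta_right0 e'0.
exists (Num.min t (e / (2 * N%:R))); first by rewrite lt_min t0.
move=> T M P f PM Mf hf.
have p0 o : 0 <= P (f @^-1` [set o]) by exact: (fa_ge0 PM).
have bound (F : option I -> R) : (forall o, o != None -> F o <= e / (2 * N%:R)) ->
    \sum_(o | o != None) F o <= e / 2.
  move=> hF; apply: le_trans (ler_sum _ hF) _.
  rewrite sumr_const -[_ *+ #|_|]mulr_natr.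
  apply: (@le_trans _ _ (e / (2 * N%:R) * N%:R)).
    by rewrite ler_wpM2l ?(ltW e'0)// ler_nat max_card.
  by rewrite invfM mulrA divfK ?gt_eqF.
have h1 : \sum_(o | o != None) eta (P (f @^-1` [set o])) <= e / 2.
  apply: bound => -[i|//] _; apply/ltW/ht => //.
  by have := hf i; rewrite lt_min => /andP[].
have h2 : \sum_(o | o != None) P (f @^-1` [set o]) <= e / 2.
  apply: bound => -[i|//] _; apply/ltW.
  by have := hf i; rewrite lt_min => /andP[].
have h3 := sum_fa_preimage PM Mf.
rewrite /entropy (bigD1 None)//=; rewrite (bigD1 None)//= in h3.
have := eta_gibbs (p0 None) (@ltr01 R); rewrite ln1 mulr0 oppr0 add0r.
lra.
Qed.

Section FiberEntropyBound.
Context {R : realType} {X Y : topologicalType}.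
Hypotheses (HX : sep_lc_metrizable R X) (HY : sep_lc_metrizable R Y).
Variables (phi : X -> X) (varphi : Y -> Y) (pi : X -> Y).
Hypotheses (phi_cont : continuous phi) (varphi_cont : continuous varphi)
  (pi_cont : continuous pi) (pi_proper : proper_map pi)
  (semiconj : pi \o phi = varphi \o pi).

Lemma semiconj_iter n x : pi (iter n phi x) = iter n varphi (pi x).
Proof.
elim: n => [//|n IH]; rewrite !iterS -IH.
by have := congr1 (@^~ (iter n phi x)) semiconj.
Qed.

Variable b : R.
Hypothesis b0 : 0 <= b.
Hypothesis covers : forall (k : nat) (K : 'I_k -> set X),
  (forall i, compact (K i)) ->
  (forall i j x, K i x -> K j x -> i = j) ->
  forall y, safe_covers phi K b (pi @^-1` [set y]).

(* The fibrewise covers extend to neighbourhoods of the fibres because [pi] is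
   closed; off a compact set of fibres nothing needs to be separated. *)
Lemma local_counting (k : nat) (a : X -> 'I_k) (K : 'I_k -> set X) :
  (forall i, compact (K i)) -> (forall i x, K i x -> a x = i) ->
  exists (s : nat) (W : 'I_s -> set Y) (M : nat), (forall i, open (W i)) /\
    let c := fun y => [ffun i : 'I_s => `[< W i y >]] in
    let g := fun x => (c (pi x),
      if `[< exists i, K i x >] then None else Some (a x)) in
    forall x0, exists n1, [/\ (0 < n1)%N, (n1 <= M)%N & forall m,
     (0 < m)%N -> (m <= n1)%N -> exists2 L : seq (seq 'I_k),
     (size L)%:R <= expR (b * n1%:R) &
     forall x, name phi g m x = name phi g m x0 -> name phi a m x \in L].
Proof.
move=> cK Ka.
have hX : hausdorff_space X by case: HX => _ _ [d dX]; exact: dist_hausdorff dX.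
have hY : hausdorff_space Y by case: HY => _ _ [d dY]; exact: dist_hausdorff dY.
have clK i : closed (K i) by exact: compact_closed.
have disjK i j x : K i x -> K j x -> i = j by move=> /Ka <- /Ka <-.
have tube y : exists (n N : nat) (O : 'I_N -> set X) (W : set Y),
    [/\ (0 < n)%N, N%:R <= expR (b * n%:R), forall l, safe phi K n (O l),
    open W /\ W y & pi @^-1` W `<=` \bigcup_l O l].
  have [n [N [U [n0 NC sU yU]]]] := covers cK disjK y.
  have [ O hO] := choice (fun l => safe_thickening phi_cont clK (sU l)).
  have [ | |W [oW Wy WO]] := @proper_closed_nbhs _ _ _ y (\bigcup_l O l) hY
    (locally_compact_nbhs HY y) pi_cont pi_proper.
  - by apply: bigcup_open => l _; case: (hO l).
  - by move=> x /yU[l _ Ul]; exists l => //; case: (hO l) => _ UO _; exact: UO.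
  by exists n, N, O, W; split => // l; case: (hO l).
have [n tube1] := choice tube.
have [N tube2] := choice tube1.
pose Q y (OW : ('I_(N y) -> set X) * set Y) :=
  [/\ (0 < n y)%N, (N y)%:R <= expR (b * (n y)%:R),
      forall l, safe phi K (n y) (OW.1 l),
      open OW.2 /\ OW.2 y & pi @^-1` OW.2 `<=` \bigcup_l OW.1 l].
have exQ y : exists OW, Q y OW by case: (tube2 y) => O [W h]; exists (O, W).
pose OW y := sval (cid (exQ y)).
have OWQ y : Q y (OW y) by exact: svalP.
have cpK : compact (pi @` \bigcup_(i in [set` enum 'I_k]) K i).
  apply: continuous_compact; first exact: continuous_subspaceT.
  by rewrite bigcup_seq; apply: bigsetU_compact => i _.
have [ | |ys KD] := compact_finite_cover (f := fun y => (OW y).2) cpK.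
- by move=> y; case: (OWQ y) => _ _ _ [].
- by move=> y _; exists y; case: (OWQ y) => _ _ _ [].
exists (size ys), (fun i => (OW (tnth (in_tuple ys) i)).2).
(* The successor keeps the bound positive even when [ys] is empty, for the blocks of length 1
   below. *)
exists (\max_(i < size ys) n (tnth (in_tuple ys) i)).+1; split.
  by move=> i; case: (OWQ (tnth (in_tuple ys) i)) => _ _ _ [].
move=> c g x0.
have nameg0 m x : (0 < m)%N -> name phi g m x = name phi g m x0 ->
    c (pi x) = c (pi x0).
  by move=> m0 /name_eqP/(_ 0%N m0)[].
(* Away from the compacts, [g] itself records the label [a]; safety is called upon only when both
   points visit compacts. *)
have gd i x y : g (iter i phi x) = g (iter i phi y) ->
    (exists j, K j (iter i phi x)) /\ (exists j, K j (iter i phi y)) \/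
    a (iter i phi x) = a (iter i phi y).
  by move=> [_]; case: asboolP => hx; case: asboolP => hy//; [left|move=> [->]; right].
have [[i Wi]|noW] := pselect (exists i, (OW (tnth (in_tuple ys) i)).2 (pi x0)).
  set y := tnth (in_tuple ys) i in Wi.
  case: (OWQ y) => n0 NC sO _ WO.
  exists (n y); split => //.
    by apply: leqW; rewrite /y; apply: (leq_bigmax i).
  move=> m m0 mn.
  pose pick l := xget x0 [set x | (OW y).1 l x /\ name phi g m x = name phi g m x0].
  exists [seq name phi a m (pick l) | l <- enum 'I_(N y)].
    by rewrite size_map size_enum_ord.
  move=> x gx; have Wx : (OW y).2 (pi x).
    have := nameg0 m x m0 gx; rewrite /c => /ffunP/(_ i); rewrite !ffunE.
    by rewrite -/y => e; apply/asboolP; rewrite e; apply/asboolP.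
  have [l _ Ol] := WO x Wx; apply/mapP; exists l; first by rewrite mem_enum.
  have [Ol' gl] : (OW y).1 l (pick l) /\ name phi g m (pick l) = name phi g m x0.
    by rewrite /pick; case: xgetP => [z -> []//|/(_ x)[]].
  apply/name_eqP => j jm.
  have /name_eqP/(_ j jm)/gd[[[i1 K1] [i2 K2]]|//] : name phi g m x = name phi g m (pick l).
    by rewrite gx gl.
  rewrite (Ka _ _ K1) (Ka _ _ K2).
  by apply: (sO l j i1 i2 x (pick l)) => //; exact: leq_trans mn.
(* Outside the open sets [x0] lies in none of the compacts, and nor does any point with the same [g]
   label, so one step of [g] determines one step of [a]. *)
exists 1%N; split => // m m0 m1.
exists [:: name phi a m x0].
  by rewrite /= -(@expR0 R) ler_expR mulr_ge0.
move=> x gx; rewrite inE; apply/eqP/name_eqP => j jm.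
move/name_eqP/(_ j jm)/gd : (gx) => [[[i1 K1] _]|//]; exfalso.
have j0 : j = 0%N by lia.
subst j; move: K1 => /= K1.
have [y yD Wy] : exists2 y, y \in ys & (OW y).2 (pi x).
  by apply: KD; exists x => //; exists i1 => //=; rewrite mem_enum.
have yys : (index y ys < size ys)%N by rewrite index_mem.
apply: noW; exists (Ordinal yys).
have := nameg0 m x m0 gx; rewrite /c => /ffunP/(_ (Ordinal yys)); rewrite !ffunE.
rewrite (tnth_nth y)/= nth_index// => e; apply/asboolP.
by rewrite -e; apply/asboolP.
Qed.


(** A slack [e] is fixed in advance because the compacts, hence both auxiliary partitions, depend on
    it. *)
Lemma rate_fiber_le (x0 : X) (mu : probability (borelType x0) R) (k : nat)
    (a : X -> 'I_k) :
  invariant_measure mu phi -> label (@measurable _ (borelType x0)) a ->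
  ((rate (realprob mu) phi a)%:E <= topological_entropy R varphi + b%:E)%E.
Proof.
move=> muphi Ma; apply/lee_addgt0Pr => e e0.
have MS (A : set (borelType x0)) : measurable A ->
    measurable (phi @^-1` A : set (borelType x0)).
  exact: continuous_borel.
have PS (A : set (borelType x0)) : measurable A ->
    realprob mu (phi @^-1` A) = realprob mu A by exact: realprobS.
have PM := realprob_fa mu.
have [nu nuE] := pushforward_probability_exists mu pi_cont.
have nuphi : invariant_measure nu varphi.
  move=> B mB; rewrite !nuE -[RHS]muphi; last exact: continuous_borel.
  congr (mu _); apply/seteqP; split => x /=;
    by rewrite (congr1 (@^~ x) semiconj : pi (phi x) = _).
have MSY (A : set (borelType (pi x0))) :
    measurable A ->
    measurable (varphi @^-1` A : set (borelType (pi x0))).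
  exact: continuous_borel.
have [dlt dlt0 hdlt] := entropy_option_small 'I_k e0.
have exK i : exists Ki : set (borelType x0), [/\ @compact X Ki,
    Ki `<=` a @^-1` [set i] & (mu ((a @^-1` [set i]) `\` Ki) < dlt%:E)%E].
  exact: compact_inner_regular.
have [K hK] := choice exK.
have cK i : @compact X (K i) by case: (hK i).
have Ka i x : K i x -> a x = i by case: (hK i) => _ + _ => /[apply].
have mK i : measurable (K i : set (borelType x0)).
  apply: closed_borel; apply: compact_closed (cK i).
  by case: HX => _ _ [d dX]; exact: dist_hausdorff dX.
have [s [W [M [oW hW]]]] := local_counting cK Ka.
set c := fun y => [ffun i : 'I_s => `[< W i y >]] in hW.
pose dl x := if `[< exists i, K i x >] then None else Some (a x).
have Mdl : label (@measurable _ (borelType x0)) dl.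
  have mU : measurable (\bigcup_(i in [set` enum 'I_k]) (K i : set (borelType x0))).
    by rewrite bigcup_seq; apply: bigsetU_measurable => i _.
  have UE x : (\bigcup_(i in [set` enum 'I_k]) K i) x <-> exists i, K i x.
    by split => [[i _ Ki]|[i Ki]]; exists i => //=; rewrite mem_enum.
  case=> [i|]; last first.
    rewrite (_ : _ @^-1` _ = \bigcup_(i in [set` enum 'I_k]) K i)//.
    apply/seteqP; split => x /=; rewrite /dl.
      by case: asboolP => // /UE.
    by move/UE/asboolP => ->.
  rewrite (_ : _ @^-1` _ = (a @^-1` [set i]) `\`
      \bigcup_(i in [set` enum 'I_k]) K i); first exact: measurableD.
  apply/seteqP; split => x /=; rewrite /dl.
    by case: asboolP => // nK [->]; split => // /UE.
  by move=> [<- nK]; case: asboolP => // /UE.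
have Mc : label (@measurable _ (borelType (pi x0))) c.
  by apply: (label_membership (realprob_fa nu)) => i; apply: open_borel; exact: oW.
have Mcpi : label (@measurable _ (borelType x0)) (c \o pi).
  by move=> w; exact: continuous_borel pi_cont _ (Mc w).
have Hd : entropy (realprob mu) dl <= e.
  apply: (hdlt _ _ _ _ PM Mdl) => i; rewrite -lte_fin.
  have mai : measurable ((a @^-1` [set i] `\` K i) : set (borelType x0)).
    by apply: measurableD => //; exact: Ma.
  apply: (@le_lt_trans _ _ (realprob mu ((a @^-1` [set i]) `\` K i))%:E).
    rewrite lee_fin; apply: (fa_le PM) => //.
    move=> x /=; rewrite /dl; case: asboolP => // nK [->]; split => //.
    by move=> Ki; apply: nK; exists i.
  by rewrite -realprobE//; case: (hK i).
have rcE : rate (realprob mu) phi (c \o pi) = rate (realprob nu) varphi c.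
  rewrite /rate; congr (limn _); apply/funext => n; congr (_ * _).
  apply: eq_bigr => w _; congr eta; rewrite /realprob nuE; congr (fine (mu _)).
  apply/seteqP; split => x /= <-; apply/ffunP => i; rewrite !ffunE/=;
    by rewrite semiconj_iter.
have Mg := label_pair PM Mcpi Mdl.
have : rate (realprob mu) phi a <= rate (realprob mu) phi (c \o pi) + (e + b).
  (* The overrun [b * M] of the last block disappears in the rate, while names of [dl] of length [n]
     cost at most [n * e] by subadditivity. *)
  apply: (@rate_le _ _ _ _ PM _ MS PS _ _ _ _ _ (b * M%:R)) => // n n0.
  apply: le_trans (@entropy_le_count _ _ _ _ PM _ _ _
    (itinerary phi (fun x => (c (pi x), dl x)) n) (expR (b * (n + M)%:R)) _ _ _ _) _.
  - exact: (label_itinerary PM MS).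
  - exact: (label_itinerary PM MS).
  - exact: expR_gt0.
  - move=> x1; apply: count_itineraries.
    exact: (count_names (M := M) b0 hW).
  rewrite expRK.
  have h1 : entropy (realprob mu) (itinerary phi (fun x => (c (pi x), dl x)) n) <=
      entropy (realprob mu) (itinerary phi (c \o pi) n) +
      entropy (realprob mu) (itinerary phi dl n).
    have M1 := label_itinerary PM MS (n := n) Mcpi.
    have M2 := label_itinerary PM MS (n := n) Mdl.
    apply: le_trans (entropy_pair_le PM M1 M2).
    apply: (entropy_le_determined PM); [exact: (label_itinerary PM MS)|exact: (label_pair PM)|].
    move=> x y [/itinerary_eqP e1 /itinerary_eqP e2]; apply/itinerary_eqP => i im.
    by congr pair; [exact: e1|exact: e2].
  have h2 := entropy_itinerary_le PM MS PS n Mdl.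
  have h3 : n%:R * entropy (realprob mu) dl <= n%:R * e by rewrite ler_wpM2l.
  rewrite natrD !mulrDr; rewrite [b * n%:R]mulrC; lra.
rewrite rcE => h.
have : ((rate (realprob nu) varphi c)%:E <= topological_entropy R varphi)%E.
  apply: le_trans (KS_entropy_ge MSY nuphi Mc) _.
  by apply: ereal_sup_ubound; right; exists (pi x0), nu.
move=> h'; apply: (@le_trans _ _ ((rate (realprob nu) varphi c)%:E + (e + b)%:E)%E).
  by rewrite -EFinD lee_fin.
by rewrite EFinD addeA addeAC leeD2r// leeD2r.
Qed.

Lemma topological_entropy_fiber_le :
  (topological_entropy R phi <= topological_entropy R varphi + b%:E)%E.
Proof.
apply: ge_ereal_sup => _ [->|[x0 [mu [muphi ->]]]].
  by apply: adde_ge0; rewrite ?lee_fin//; apply: ereal_sup_ubound; left.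
apply: KS_entropy_le => //.
- by move=> A; exact: continuous_borel.
- by move=> k a; exact: rate_fiber_le.
Qed.

End FiberEntropyBound.

(** * Measures from finitely additive measures *)

Section MeasureOfFinitelyAdditive.
Context {R : realType} {T : topologicalType} {t0 : T}.
Variable d : T -> T -> R.
Hypothesis dT : compatible_distance d.
Hypothesis cT : compact [set: T].
Variable l : set T -> R.
Hypothesis lM : finitely_additive (fun=> True) l.

Local Open Scope ereal_scope.

(** As for the Riesz representation theorem: open sets are measured through their compact subsets,
    arbitrary sets through their open supersets. Mass may move onto boundaries, so comparison with
    [l] gives only inequalities, in opposite directions on closed and open sets. *)
Definition inner_content (G : set T) : \bar R :=
  ereal_sup [set (l K)%:E | K in [set K | compact K /\ K `<=` G]].

Definition open_outer (A : set T) : \bar R :=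
  ereal_inf [set inner_content G | G in [set G | open G /\ A `<=` G]].

Lemma le_inner_content (K G : set T) : compact K -> K `<=` G ->
  (l K)%:E <= inner_content G.
Proof. by move=> cK KG; apply: ereal_sup_ubound; exists K. Qed.

Lemma inner_content_le (G : set T) (x : \bar R) :
  (forall K, compact K -> K `<=` G -> (l K)%:E <= x) -> inner_content G <= x.
Proof. by move=> h; apply: ge_ereal_sup => _ [K [cK KG] <-]; exact: h. Qed.

Lemma inner_content_ge0 G : 0 <= inner_content G.
Proof.
have -> : 0 = (l set0)%:E by rewrite (fa_0 lM).
by apply: le_inner_content; [exact: compact0|exact: sub0set].
Qed.

Lemma inner_content_le_l G : inner_content G <= (l G)%:E.
Proof.
by apply: inner_content_le => K cK KG; rewrite lee_fin (fa_le lM).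
Qed.

Lemma inner_contentS (G H : set T) : G `<=` H ->
  inner_content G <= inner_content H.
Proof.
move=> GH; apply: inner_content_le => K cK KG; apply: le_inner_content => //.
exact: subset_trans GH.
Qed.

Lemma open_outer_ge0 A : 0 <= open_outer A.
Proof.
by apply: le_ereal_inf_tmp => _ [G _ <-]; exact: inner_content_ge0.
Qed.

Lemma open_outerS A B : A `<=` B -> open_outer A <= open_outer B.
Proof.
move=> AB; apply: ereal_inf_le_tmp => _ [G [oG BG] <-]; exists G => //; split => //.
exact: subset_trans BG.
Qed.

Lemma open_outer_open G : open G -> open_outer G = inner_content G.
Proof.
move=> oG; apply/eqP; rewrite eq_le; apply/andP; split.
  by apply: ereal_inf_lbound; exists G => //; split.
by apply: le_ereal_inf_tmp => _ [H [oH GH] <-]; exact: inner_contentS.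
Qed.

Lemma open_outer_le (A G : set T) : open G -> A `<=` G ->
  open_outer A <= inner_content G.
Proof. by move=> oG AG; apply: ereal_inf_lbound; exists G. Qed.

Lemma open_outer_fin A : open_outer A \is a fin_num.
Proof.
rewrite ge0_fin_numE ?open_outer_ge0//; apply: (@le_lt_trans _ _ 1); last exact: ltry.
apply: le_trans (open_outer_le openT (@subsetT _ _)) _.
by apply: le_trans (inner_content_le_l _) _; rewrite (fa_total lM).
Qed.

(** The part of [K] outside [G2] is thickened by half its distance to the complement of [G1]; the
    closure of the thickening cuts out [K1], its complement [K2]. *)
Lemma compact_split (K G1 G2 : set T) : compact K -> open G1 -> open G2 ->
  K `<=` G1 `|` G2 -> exists K1 K2,
  [/\ compact K1, compact K2, K1 `<=` G1, K2 `<=` G2 & K `<=` K1 `|` K2].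
Proof.
move=> cK oG1 oG2 KG.
have cQ : compact (K `&` ~` G2) by apply: compact_closedI cK _; exact: open_closedC.
have [|e e0 he] := compact_uniform_dball dT cQ oG1.
  by move=> x [/KG[G1x _//|G2x /(_ G2x)]].
have e20 : (0 < e / 2)%R by rewrite divr_gt0.
pose V := \bigcup_(x in K `&` ~` G2) [set y | (d x y < e / 2)%R].
have oV : open V by apply: bigcup_open => x _; exact: open_dball dT _ _.
exists (K `&` closure V), (K `&` ~` V); split.
- by apply: compact_closedI => //; exact: closed_closure.
- by apply: compact_closedI => //; exact: open_closedC.
- move=> y [_ /(_ _ (nbhs_dball dT y e20))[z [[x Qx /= xz] /= yz]]].
  apply: (he x) => //; have := dist_triangle dT x z y.
  by rewrite (dist_sym dT z y); lra.
- move=> x [Kx nVx]; apply: contrapT => nG2; apply: nVx; exists x => //=.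
  by rewrite (distxx dT).
- move=> x Kx; have [Vx|nVx] := pselect (V x); last by right.
  by left; split => //; exact: subset_closure.
Qed.

Lemma inner_content_bigsetU (G : (set T)^nat) (N : nat) (K : set T) :
  (forall n, open (G n)) -> compact K -> K `<=` \big[setU/set0]_(i < N) G i ->
  (l K)%:E <= \sum_(i < N) inner_content (G i).
Proof.
move=> oG; elim: N K => [|N IH] K cK.
  by rewrite !big_ord0 subset0 => ->; rewrite (fa_0 lM).
rewrite !big_ord_recr/= => KG.
have oU : open (\big[setU/set0]_(i < N) G i).
  by rewrite -bigcup_mkord; apply: bigcup_open => i _; exact: oG.
have [K1 [K2 [cK1 cK2 K1G K2G K12]]] := compact_split cK oU (oG N) KG.
apply: (@le_trans _ _ (l K1 + l K2)%:E).
  rewrite lee_fin; apply: (@le_trans _ _ (l (K1 `|` K2))); first exact: (fa_le lM).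
  have s12 : K1 `<=` K1 `|` K2 by move=> x; left.
  rewrite -(setDUK s12) (fa_add lM)// ?setDIK// lerD2l.
  by apply: (fa_le lM) => // x [[//|]].
by rewrite EFinD leeD ?IH// le_inner_content.
Qed.

(** A compact subset of a countable union of open sets lies in a finite subunion, where finite
    subadditivity applies. *)
Lemma open_outer_sigma_subadditive : sigma_subadditive open_outer.
Proof.
move=> F; apply/lee_addgt0Pr => e e0.
have exG n : exists G : set T, [/\ open G, F n `<=` G &
    inner_content G <= open_outer (F n) + (e / (2 ^ n.+1)%:R)%:E].
  have en : (0 < e / (2 ^ n.+1)%:R)%R by rewrite divr_gt0// ltr0n expn_gt0.
  have [_ [G [oG FG] <-] h] := lb_ereal_inf_adherent en (open_outer_fin (F n)).
  by exists G; split => //; exact: ltW.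
have [G hG] := choice exG.
have oG n : open (G n) by case: (hG n).
apply: (@le_trans _ _ (inner_content (\bigcup_n G n))).
  apply: open_outer_le; first exact: bigcup_open.
  by move=> x [n _ Fn]; exists n => //; case: (hG n) => _ + _; apply.
apply: (@le_trans _ _ (\sum_(n <oo) inner_content (G n))).
  apply: inner_content_le => K cK KG.
  have [| |s hs] := compact_finite_cover (f := G) cK; [by []|by move=> x /KG[n _ Gn]; exists n|].
  pose N := (\max_(i <- s) i).+1.
  apply: (@le_trans _ _ (\sum_(i < N) inner_content (G i))).
    apply: inner_content_bigsetU => // x /hs[i si Gi].
    by rewrite -bigcup_mkord; exists i => //=; rewrite ltnS; exact: leq_bigmax_seq.
  rewrite -(big_mkord xpredT (fun i => inner_content (G i))).
  by apply: nneseries_lim_ge => i _ _; exact: inner_content_ge0.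
apply: (@le_trans _ _ (\sum_(n <oo) (open_outer (F n) + (e / (2 ^ n.+1)%:R)%:E))).
  apply: lee_nneseries => [n _ _|n _]; first exact: inner_content_ge0.
  by case: (hG n).
by apply: epsilon_trick; [move=> n; exact: open_outer_ge0|exact: ltW].
Qed.

Lemma open_outer0 : open_outer set0 = 0.
Proof.
apply/eqP; rewrite eq_le open_outer_ge0 andbT (open_outer_open open0).
by apply: le_trans (inner_content_le_l _) _; rewrite (fa_0 lM).
Qed.

Let mo : set (pointed_at t0) -> \bar R := open_outer.

HB.instance Definition _ := isOuterMeasure.Build R (pointed_at t0) mo
  open_outer0 open_outer_ge0 open_outerS open_outer_sigma_subadditive.

(** First choose a compact [K1] in [G] and [O], then a compact [K2] in [G] minus [K1], which
    contains [G] minus [O]. They are disjoint, so [l] adds. *)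
Lemma open_outer_caratheodory (O : set T) : open O ->
  caratheodory_measurable mo O.
Proof.
move=> oO; apply: le_caratheodory_measurable => X.
apply: le_ereal_inf_tmp => _ [G [oG XG] <-].
apply: (@le_trans _ _ (inner_content (G `&` O) + open_outer (G `&` ~` O))).
  apply: leeD; last by apply: open_outerS; exact: setSI.
  by apply: open_outer_le; [exact: openI|exact: setSI].
rewrite -leeBrDr ?open_outer_fin//; apply: inner_content_le => K1 cK1 K1GO.
rewrite leeBrDr ?open_outer_fin// addeC -leeBrDr//.
have clK1 : closed K1 by apply: compact_closed cK1; exact: dist_hausdorff dT.
apply: (@le_trans _ _ (inner_content (G `&` ~` K1))).
  apply: open_outer_le; first by apply: openI => //; exact: closed_openC.
  by move=> x [Gx nO]; split => // /K1GO[].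
apply: inner_content_le => K2 cK2 K2G; rewrite leeBrDr// -EFinD -(fa_add lM)//.
  apply: le_inner_content; first exact: compactU.
  by move=> x [/K2G[]//|/K1GO[]].
by rewrite -subset0 => x [/K2G[_ nK1] /nK1].
Qed.

Lemma open_outer_borel (A : set (borelType t0)) : measurable A ->
  caratheodory_measurable mo A.
Proof.
move=> mA; have : smallest (sigma_algebra setT) (@open T) A by exact: mA.
apply: smallest_sub => //; last exact: open_outer_caratheodory.
split.
- exact: caratheodory_measurable_set0.
- by move=> B mB; rewrite setTD; exact: caratheodory_measurable_setC.
- by move=> B mB; exact: caratheodory_measurable_bigcup.
Qed.

Lemma finitely_additive_measure : exists m : probability (borelType t0) R,
  [/\ forall K : set (borelType t0), @closed T K -> (l K <= realprob m K)%R,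
      forall G : set (borelType t0), @open T G -> (realprob m G <= l G)%R &
      forall G : set (borelType t0), @open T G -> m G = inner_content G].
Proof.
have ms : semi_sigma_additive (open_outer : set (borelType t0) -> \bar R).
  move=> F mF tF mUF.
  apply: (@caratheodory_measure_sigma_additive _ _ mo F) => //.
    by move=> n; exact: open_outer_borel.
  exact: open_outer_borel.
have m1 : open_outer [set: T] = 1.
  rewrite (open_outer_open openT); apply/eqP; rewrite eq_le; apply/andP; split.
    by apply: le_trans (inner_content_le_l _) _; rewrite (fa_total lM).
  have -> : 1 = (l setT)%:E by rewrite (fa_total lM).
  exact: le_inner_content.
have [m mE] := probability_exists (T := borelType t0) open_outer0
  open_outer_ge0 ms m1.
exists m; split.
- move=> K clK; rewrite -lee_fin -realprobE ?mE; last exact: closed_borel.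
  apply: le_ereal_inf_tmp => _ [G [oG KG] <-]; apply: le_inner_content => //.
  exact: (subclosed_compact clK cT).
- move=> G oG; rewrite -lee_fin -realprobE ?mE; last exact: open_borel.
  by rewrite (open_outer_open oG) inner_content_le_l.
- by move=> G oG; rewrite mE (open_outer_open oG).
Qed.

Lemma finitely_additive_invariant_measure (tau : T -> T) : continuous tau ->
  (forall A, l (tau @^-1` A) = l A) ->
  exists m : probability (borelType t0) R,
  [/\ forall K : set (borelType t0), @closed T K -> (l K <= realprob m K)%R,
      forall G : set (borelType t0), @open T G -> (realprob m G <= l G)%R &
      invariant_measure m tau].
Proof.
move=> ctau ltau; have [m [mK mG mE]] := finitely_additive_measure.
exists m; split => //.
have mtau (A : set (borelType t0)) : measurable A ->
    measurable (tau @^-1` A : set (borelType t0)) by exact: continuous_borel.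
have le_open (G : set (borelType t0)) : @open T G -> m (tau @^-1` G) <= m G.
  move=> oG; have otG : @open T (tau @^-1` G).
    by apply: open_comp => // x _; exact: ctau.
  rewrite !mE//; apply: inner_content_le => K cK KG.
  have ctK : compact (tau @` K).
    by apply: continuous_compact cK; exact: continuous_subspaceT.
  apply: (@le_trans _ _ (l (tau @` K))%:E).
    by rewrite lee_fin -(ltau (tau @` K)); apply: (fa_le lM) => // x Kx; exists x.
  by apply: le_inner_content => // _ [x Kx <-]; exact: KG.
have le_borel (B : set (borelType t0)) : measurable B ->
    m (tau @^-1` B) <= m B.
  move=> mB; apply/lee_addgt0Pr => e e0.
  have [F [G [cF oG FB BG hFG]]] := borel_regular dT m mB e0.
  have mG' : measurable G by exact: open_borel.
  have mF : measurable F by exact: closed_borel.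
  apply: (@le_trans _ _ (m (tau @^-1` G))).
    by apply: le_measure; rewrite ?inE; [exact: mtau|exact: mtau|exact: preimage_subset].
  apply: le_trans (le_open _ oG) _.
  apply: (@le_trans _ _ (m (B `|` (G `\` F)))).
    apply: le_measure; rewrite ?inE//; first by apply: measurableU => //; exact: measurableD.
    move=> x Gx; have [Fx|nF] := pselect (F x); first by left; exact: FB.
    by right.
  apply: le_trans (measureU2 _ _ _) _ => //; first exact: measurableD.
  by rewrite leeD2l// ltW.
move=> B mB; apply/eqP; rewrite eq_le le_borel//=.
have := le_borel (~` B) (measurableC mB).
rewrite preimage_setC !probability_setC//; last exact: mtau.
rewrite !realprobE//; last exact: mtau.
by rewrite -!EFinB !lee_fin; lra.
Qed.

End MeasureOfFinitelyAdditive.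

(** * The variational principle on a compact space *)

(** Radii of spheres with positive mass are the atoms of the law of [d x]. They are countably many,
    whereas an interval has positive length. *)
Lemma null_sphere (R : realType) (T : topologicalType) (t0 : T)
    (d : T -> T -> R) (m : probability (borelType t0) R) (x : T) (e : R) :
  compatible_distance d -> 0 < e ->
  exists r : R, [/\ 0 < r, r < e & m [set y | d x y = r] = 0%E].
Proof.
move=> dT e0.
have mX : measurable_fun [set: borelType t0] (d x : borelType t0 -> R).
  apply: (measurability _ (measurable_realfun.RGenOInfty.measurableE R)) => _ [_ [r ->] <-].
  rewrite setTI; apply: open_borel.
  have -> : d x @^-1` `]r, +oo[%classic = ~` [set y | d x y <= r].
    by apply/seteqP; split => y /=; rewrite in_itv/= andbT -?ltNge ltNge => /negP.
  exact/closed_openC/closed_dball.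
pose X : {mfun borelType t0 >-> R} :=
  HB.pack (d x : borelType t0 -> R) (isMeasurableFun.Build _ _ _ _ _ mX).
have cX := @pmf_gt0_countable _ _ _ m X.
apply: contrapT => h.
have sub : `]0, e[%classic `<=` [set r | 0 < pmf (P := m) X r].
  move=> r /=; rewrite in_itv/= => /andP[r0 re].
  rewrite lt_neqAle pmf_ge0 andbT eq_sym; apply/eqP => p0; apply: h.
  have mr : measurable (X @^-1` [set r]) by exact: measurable_funPTI.
  exists r; split => //; rewrite -[LHS]fineK; last by rewrite fin_num_measure.
  by rewrite (p0 : fine (m [set y | d x y = r]) = 0).
have := countable_lebesgue_measure0 (sub_countable (subset_card_le sub) cX).
rewrite lebesgue_measure_itv/= lte_fin e0 -EFinB subr0 => -[/eqP].
by rewrite gt_eqF.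
Qed.

Section AveragedMeasures.
Context {R : realType} {T : Type}.

Let allsets := (fun=> True) : set T -> Prop.

Lemma fa_dirac (x : T) :
  finitely_additive allsets (fun A => (`[< A x >])%:R : R).
Proof.
split => //.
- by rewrite asboolT.
- move=> A B _ _ AB; rewrite asbool_or; case: asboolP => Ax; case: asboolP => Bx;
    rewrite ?addr0 ?add0r//=.
  by exfalso; have : (A `&` B) x by []; rewrite AB.
Qed.

Lemma fa_average (n : nat) (l : nat -> set T -> R) : (0 < n)%N ->
  (forall i, finitely_additive allsets (l i)) ->
  finitely_additive allsets (fun A => n%:R^-1 * \sum_(i < n) l i A).
Proof.
move=> n0 hl; split => //.
- move=> A _; rewrite mulr_ge0 ?invr_ge0// sumr_ge0// => i _.
  exact: (fa_ge0 (hl i)).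
- rewrite (eq_bigr (fun=> 1)) ?sumr_const ?card_ord ?mulVf ?pnatr_eq0 -?lt0n//.
  by move=> i _; exact: (fa_total (hl i)).
- move=> A B _ _ AB; rewrite -mulrDr -big_split/=; congr (_ * _).
  by apply: eq_bigr => i _; exact: (fa_add (hl i)).
Qed.

Lemma fa_map (f : T -> T) (l : set T -> R) : finitely_additive allsets l ->
  finitely_additive allsets (fun A => l (f @^-1` A)).
Proof.
move=> hl; split => //.
- by move=> A _; exact: (fa_ge0 hl).
- by rewrite preimage_setT (fa_total hl).
- move=> A B _ _ AB; rewrite preimage_setU (fa_add hl)//.
  by rewrite -preimage_setI AB preimage_set0.
Qed.

Lemma fa_cvg (F : set_system nat) (l : nat -> set T -> R) (k : set T -> R) :
  ProperFilter F -> (forall n, finitely_additive allsets (l n)) ->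
  (forall A, l ^~ A @ F --> k A) -> finitely_additive allsets k.
Proof.
move=> FF hl hk; split => //.
- move=> A _; apply: ler_cvg_to (cvg_cst (0 : R)) (hk A) _.
  by apply: nearW => n; exact: (fa_ge0 (hl n)).
- have : (fun n => l n setT) @ F --> (1 : R).
    under eq_fun do rewrite (fa_total (hl _)); exact: cvg_cst.
  by move=> /(cvg_unique _ (hk setT)) ->.
- move=> A B _ _ AB.
  have : (fun n => l n (A `|` B)) @ F --> k A + k B.
    under eq_fun do rewrite (fa_add (hl _))//; exact: cvgD.
  by move=> /(cvg_unique _ (hk (A `|` B))) ->.
Qed.

(** A cell contains at most one of the [n] points, hence has mass at most 1 / n and is charged at
    least [ln n] per unit of mass. *)
Lemma entropy_uniform_ge (I : finType) (f : T -> I) (n : nat) (p : nat -> T) :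
  (0 < n)%N ->
  (forall i j, (i < n)%N -> (j < n)%N -> f (p i) = f (p j) -> i = j) ->
  ln n%:R <= entropy
    (fun A => n%:R^-1 * \sum_(i < n) (`[< A (p i) >])%:R : R) f.
Proof.
move=> n0 injf; pose P (A : set T) : R := n%:R^-1 * \sum_(i < n) (`[< A (p i) >])%:R.
have PM : finitely_additive allsets P.
  by apply: (fa_average n0 (l := fun i A => (`[< A (p i) >])%:R)) => i; exact: fa_dirac.
have nR : 0 < n%:R :> R by rewrite ltr0n.
have Ple w : P (f @^-1` [set w]) <= n%:R^-1.
  rewrite /P ler_piMr ?invr_ge0// -natr_sum lern1.
  have -> : (\sum_(i < n) `[< (f @^-1` [set w]) (p i) >] =
      \sum_(i < n | f (p i) == w) 1)%N.
    rewrite [RHS]big_mkcond; apply: eq_bigr => i _.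
    by case: asboolP => /= [->|/eqP/negbTE->//]; rewrite eqxx.
  rewrite sum1_card; apply/card_le1_eqP => i j.
  rewrite !unfold_in => /eqP fi /eqP fj.
  by apply/val_inj/injf; [exact: ltn_ord|exact: ltn_ord|rewrite fi fj].
have s1 : \sum_w P (f @^-1` [set w]) = 1 by exact: (sum_fa_preimage PM).
rewrite -[leLHS]mul1r -[X in X * _ <= _]s1 mulr_suml.
apply: ler_sum => w _.
change (P (f @^-1` [set w]) * ln n%:R <= eta (P (f @^-1` [set w]))).
have := fa_ge0 PM (A := f @^-1` [set w]) Logic.I.
rewrite le_eqVlt => /predU1P[<-|Pw]; first by rewrite mul0r eta0.
rewrite /eta -mulrN ler_pM2l// lerNr -lnV ?posrE//.
by rewrite ler_ln ?posrE ?invr_gt0.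
Qed.

Lemma sum_ord_mul (q N : nat) (F : nat -> R) :
  \sum_(s < q * N) F s = \sum_(r < N) \sum_(j < q) F (j + r * q)%N.
Proof.
elim: N => [|N IH]; first by rewrite muln0 !big_ord0.
rewrite mulnS addnC big_split_ord/= big_ord_recr/= IH; congr (_ + _).
by apply: eq_bigr => j _; rewrite mulnC addnC.
Qed.

Variable tau : T -> T.

(** From the offset [j], [N] blocks of length [q] reach past time [q * N]; the first [j <= q]
    symbols cost at most [q * ln #|I|]. *)
Lemma entropy_blocks (I : finType) (f : T -> I) (P : set T -> R) (q N j : nat) :
  (0 < #|I|)%N -> (j <= q)%N -> finitely_additive allsets P ->
  entropy P (itinerary tau f (q * N)) <= q%:R * ln #|I|%:R +
    \sum_(r < N) entropy P (itinerary tau f q \o iter (j + r * q) tau).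
Proof.
move=> I0 jq PM; have Mf J (g : T -> J) : label allsets g by [].
have h1 : entropy P (itinerary tau f (q * N) \o iter j tau) <=
    \sum_(r < N) entropy P (itinerary tau f q \o iter (j + r * q) tau).
  elim: N => [|N IH].
    rewrite big_ord0; apply: le_trans (entropy_le_ln_card PM _ _) _ => //.
      by rewrite card_ffun card_ord muln0 expn0.
    by rewrite card_ffun card_ord muln0 expn0 ln1.
  rewrite big_ord_recr/=; apply: le_trans (lerD IH (lexx _)).
  apply: le_trans (entropy_pair_le PM _ _) => //.
  apply: (entropy_le_determined PM) => // x y [/itinerary_eqP e1 /itinerary_eqP e2].
  apply/itinerary_eqP => k kN; have [|mk] := ltnP k (q * N); first exact: e1.
  have := e2 (k - q * N)%N; rewrite -!iterD.
  have -> : (k - q * N + (j + N * q) = k + j)%N by lia.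
  by rewrite !iterD; apply; lia.
have h2 : entropy P (itinerary tau f q) <= q%:R * ln #|I|%:R.
  apply: le_trans (entropy_le_ln_card PM _ _) _ => //.
    by rewrite card_ffun card_ord expn_gt0 I0.
  by rewrite card_ffun card_ord natrX lnXn ?ltr0n// mulr_natl.
apply: le_trans (lerD h2 h1); apply: le_trans (entropy_pair_le PM _ _) => //.
apply: (entropy_le_determined PM) => // x y [/itinerary_eqP e1 /itinerary_eqP e2].
apply/itinerary_eqP => k kN; have [kj|jk] := ltnP k j; first by apply: e1; lia.
by rewrite -(subnK jk) !iterD; apply: e2; lia.
Qed.

End AveragedMeasures.

(** Compactness gives a cluster point, and an ultrafilter converges to its cluster points. *)
Lemma ultra_bounded_cvg (R : realType) (U : set_system nat) (u : nat -> R) :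
  UltraFilter U -> (forall n, 0 <= u n <= 1) -> exists l : R, u @ U --> l.
Proof.
move=> UU u01; have PU : ProperFilter U by exact: ultra_proper.
have Fu : U (u @^-1` `[0, 1]%classic).
  by apply: filterE => n; rewrite /= in_itv/=; exact: u01.
have [l [_ cl]] := segment_compact (fmap_proper_filter u PU) Fu.
exists l => V Vl; have [//|UV] := in_ultra_setVsetC (u @^-1` V) UU.
by have [x [/= nVx Vx]] := cl (~` V) V UV Vl.
Qed.

(** * Sets with null boundary *)

Section ContinuitySets.
Context {R : realType} {T : topologicalType} {t0 : T}.
Variable m : probability (borelType t0) R.
Variable l : set T -> R.
Hypothesis lM : finitely_additive (fun=> True) l.
Hypothesis lK : forall K : set (borelType t0), @closed T K -> l K <= realprob m K.
Hypothesis lG : forall G : set (borelType t0), @open T G -> realprob m G <= l G.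

(** Null boundary, expressed by a squeeze between an open and a closed set. The squeeze is stable
    under Boolean operations and preimages, and the two inequalities on closed and open sets then
    force [l] and [m] to agree. *)
Definition continuity_set (A : set (borelType t0)) := measurable A /\
  exists U F : set (borelType t0), [/\ @open T U, @closed T F, U `<=` A,
    A `<=` F & m (F `\` U) = 0%E].

Lemma continuity_setE (A : set (borelType t0)) : continuity_set A ->
  l A = realprob m A.
Proof.
move=> [mA [U [F [oU cF UA AF FU0]]]].
have mU : measurable U by exact: open_borel.
have mF : measurable F by exact: closed_borel.
have PM := realprob_fa m.
have FU : realprob m F = realprob m U.
  rewrite -(setDUK (subset_trans UA AF)) (fa_add PM)//; last exact: setDIK.
    by rewrite {2}/realprob FU0 addr0.
  exact: measurableD.
have h1 : l A <= l F by exact: (fa_le lM).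
have h2 : l U <= l A by exact: (fa_le lM).
have h3 := lK cF; have h4 := lG oU.
have h5 : realprob m U <= realprob m A by exact: (fa_le PM).
have h6 : realprob m A <= realprob m F by exact: (fa_le PM).
by apply/eqP; rewrite eq_le; apply/andP; split; lra.
Qed.

Lemma continuity_set_fa : finitely_additive continuity_set l.
Proof.
split; [| | |by move=> *; exact: (fa_ge0 lM)|exact: (fa_total lM)|
  by move=> *; exact: (fa_add lM)].
- split; first exact: measurableT.
  exists setT, setT; split; [exact: openT|exact: closedT|by []|by []|].
  by rewrite setDv measure0.
- move=> A [mA [U [F [oU cF UA AF FU0]]]]; split; first exact: measurableC.
  exists (~` F), (~` U); split.
  + exact: closed_openC.
  + exact: open_closedC.
  + by apply: subsetC.
  + by apply: subsetC.
  + by rewrite setDE setCK setIC -setDE.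
- move=> A B [mA [U [F [oU cF UA AF FU0]]]] [mB [V [G [oV cG VB BG GV0]]]].
  split; first exact: measurableI.
  exists (U `&` V), (F `&` G); split.
  + exact: openI.
  + exact: closedI.
  + by apply: setISS.
  + by apply: setISS.
  + have mU : measurable U by exact: open_borel.
    have mF : measurable F by exact: closed_borel.
    have mV : measurable V by exact: open_borel.
    have mG : measurable G by exact: closed_borel.
    have mFU : measurable (F `\` U) by exact: measurableD.
    have mGV : measurable (G `\` V) by exact: measurableD.
    apply/eqP; rewrite eq_le measure_ge0 andbT.
    apply: (@le_trans _ _ (m ((F `\` U) `|` (G `\` V)))).
      apply: le_measure; rewrite ?inE.
      * by apply: measurableD; exact: measurableI.
      * exact: measurableU.
      * move=> x [[Fx Gx] nUV]; have [Ux|] := pselect (U x); last by left.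
        by right; split => // Vx; apply: nUV.
    have := measureU2 m mFU mGV; rewrite [X in (_ <= X + _)%E]FU0.
    by rewrite [X in (_ <= _ + X)%E]GV0 adde0.
Qed.

Lemma continuity_set_preimage (tau : T -> T) (A : set (borelType t0)) :
  continuous tau -> invariant_measure m tau -> continuity_set A ->
  continuity_set (tau @^-1` A).
Proof.
move=> ctau mtau [mA [U [F [oU cF UA AF FU0]]]]; split.
  exact: (continuous_borel ctau).
exists (tau @^-1` U), (tau @^-1` F); split.
- by apply: open_comp => // x _; exact: ctau.
- by apply: closed_comp => // x _; exact: ctau.
- exact: preimage_subset.
- exact: preimage_subset.
- rewrite -[RHS]FU0 -[RHS]mtau//.
  by apply: measurableD; [exact: closed_borel|exact: open_borel].
Qed.

End ContinuitySets.

(** * Invariant measures from separated sets *)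

Section Misiurewicz.
Context {R : realType} {T : topologicalType} (t0 : T).
Variable d : T -> T -> R.
Hypothesis dT : compatible_distance d.
Hypothesis cT : compact [set: T].
Variable tau : T -> T.
Hypothesis ctau : continuous tau.
Variables (e b : R) (p : nat -> nat -> T) (M : nat -> nat).
Hypotheses (e0 : 0 < e) (M0 : forall n, (0 < M n)%N)
  (Mb : forall n, (0 < n)%N -> n%:R * b <= ln (M n)%:R).
Hypothesis separated : forall n i j, (0 < n)%N -> (i < M n)%N -> (j < M n)%N ->
  (forall k, (k < n)%N -> d (iter k tau (p n i)) (iter k tau (p n j)) < e) ->
  i = j.

Let sigma n (A : set T) : R :=
  (M n)%:R^-1 * \sum_(i < M n) (`[< A (p n i) >])%:R.

Let mu n (A : set T) : R := n%:R^-1 * \sum_(s < n) sigma n (iter s tau @^-1` A).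

Let sigma_fa n : finitely_additive (fun=> True) (sigma n).
Proof.
apply: (fa_average (M0 n) (l := fun i A => (`[< A (p n i) >])%:R)) => i.
exact: fa_dirac.
Qed.

Let mu_fa n : (0 < n)%N -> finitely_additive (fun=> True) (mu n).
Proof.
move=> n0; apply: (fa_average n0 (l := fun s A => sigma n (iter s tau @^-1` A))).
by move=> s; apply: fa_map; exact: sigma_fa.
Qed.

Let mu_invariant n (A : set T) : (0 < n)%N ->
  `|mu n (tau @^-1` A) - mu n A| <= n%:R^-1.
Proof.
move=> n0; rewrite /mu -mulrBr -sumrB.
have -> : \sum_(s < n) (sigma n (iter s tau @^-1` (tau @^-1` A)) -
    sigma n (iter s tau @^-1` A)) = sigma n (iter n tau @^-1` A) - sigma n A.
  rewrite -(@telescope_sumr _ 0 n (fun s => sigma n (iter s tau @^-1` A)))//.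
  by rewrite big_mkord.
rewrite normrM gtr0_norm ?invr_gt0 ?ltr0n// ler_piMr ?invr_ge0//.
have h1 := fa_ge0 (sigma_fa n) (A := A) I.
have h2 := fa_ge0 (sigma_fa n) (A := iter n tau @^-1` A) I.
have h3 := fa_le1 (sigma_fa n) (A := A) I.
have h4 := fa_le1 (sigma_fa n) (A := iter n tau @^-1` A) I.
by rewrite ler_norml; apply/andP; split; lra.
Qed.

Let entropy_mu_ge n (J : finType) (g : T -> J) : (0 < n)%N ->
  n%:R^-1 * (\sum_(s < n) entropy (sigma n) (g \o iter s tau)) <=
  entropy (mu n) g.
Proof.
move=> n0; rewrite /entropy exchange_big/= mulr_sumr; apply: ler_sum => w _.
by apply: eta_average_ge => // s; exact: (fa_ge0 (sigma_fa n)).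
Qed.

(* Misiurewicz's estimate: cut the orbit segments into blocks of length [q] in
   the [q] possible ways and average. *)
Let entropy_mu_block n (J : finType) (f : T -> J) (q : nat) :
  (0 < n)%N -> (0 < q)%N -> (q %| n)%N ->
  (forall x y, f x = f y -> d x y < e) ->
  q%:R * b <= q%:R * (q%:R * ln #|J|%:R) * n%:R^-1 +
    entropy (mu n) (itinerary tau f q).
Proof.
move=> n0 q0 /dvdnP[N nE] fe.
have {}nE : n = (q * N)%N by rewrite mulnC.
have nR : 0 < n%:R :> R by rewrite ltr0n.
have qR : 0 < q%:R :> R by rewrite ltr0n.
have J0 : (0 < #|J|)%N by apply/card_gt0P; exists (f t0).
have h1 : ln (M n)%:R <= entropy (sigma n) (itinerary tau f n).
  apply: entropy_uniform_ge; first exact: M0.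
  move=> i j iM jM /itinerary_eqP h; apply: (separated n0) => // k kn.
  by apply: fe; exact: h.
have h2 : q%:R * ln (M n)%:R <= q%:R * (q%:R * ln #|J|%:R) +
    \sum_(s < n) entropy (sigma n) (itinerary tau f q \o iter s tau).
  pose F s := entropy (sigma n) (itinerary tau f q \o iter s tau).
  have -> : \sum_(s < n) F s = \sum_(j < q) \sum_(r < N) F (j + r * q)%N.
    by rewrite nE sum_ord_mul exchange_big.
  have -> : q%:R * ln (M n)%:R = \sum_(j < q) ln (M n)%:R :> R.
    by rewrite sumr_const card_ord mulr_natl.
  have -> : q%:R * (q%:R * ln #|J|%:R) = \sum_(j < q) (q%:R * ln #|J|%:R) :> R.
    by rewrite sumr_const card_ord mulr_natl.
  rewrite -big_split/=; apply: ler_sum => j _.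
  have h1' : ln (M n)%:R <= entropy (sigma n) (itinerary tau f (q * N)).
    by rewrite -nE.
  by apply: le_trans h1' _; apply: entropy_blocks => //; exact: ltnW.
have h3 := entropy_mu_ge (itinerary tau f q) n0.
have h4 : q%:R * (n%:R * b) <= q%:R * ln (M n)%:R by rewrite ler_pM2l// Mb.
rewrite -(ler_pM2l nR) mulrDr.
have -> : n%:R * (q%:R * (q%:R * ln #|J|%:R) / n%:R) = q%:R * (q%:R * ln #|J|%:R) :> R.
  by rewrite mulrC divfK ?gt_eqF.
have h5 : \sum_(s < n) entropy (sigma n) (itinerary tau f q \o iter s tau) <=
    n%:R * entropy (mu n) (itinerary tau f q).
  by move: h3; rewrite mulrC ler_pdivrMr// mulrC.
rewrite [n%:R * _]mulrCA; lra.
Qed.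

Lemma misiurewicz : (b%:E <= topological_entropy R tau)%E.
Proof.
(* Factorial lengths are eventually divisible by each block length [q], so the cut into blocks
   leaves no remainder. *)
pose nn N := (N.+1)`!.
have nn0 N : (0 < nn N)%N by exact: fact_gt0.
have nnge N : (N <= nn N)%N by rewrite /nn factS; apply: leq_trans (leq_pmulr _ (fact_gt0 N)).
have [U [UU oU]] := ultraFilterLemma (eventually_filter).
have PU : ProperFilter U by exact: ultra_proper.
have cvgU (u : nat -> R) (x : R) : u @ \oo --> x -> u @ U --> x.
  by move=> ux V /ux; exact: oU.
have mu01 A N : 0 <= mu (nn N) A <= 1.
  by rewrite (fa_ge0 (mu_fa (nn0 N)))// (fa_le1 (mu_fa (nn0 N))).
have [l hl] := choice (fun A => ultra_bounded_cvg UU (mu01 A)).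
have lM : finitely_additive (fun=> True) l.
  by apply: (fa_cvg PU (fun N => mu_fa (nn0 N))) => A; exact: hl.
have inv_nn : (fun N => (nn N)%:R^-1 : R) @ U --> (0 : R).
  apply: cvgU; apply/cvgrPdist_lt => r r0; near=> N.
  rewrite sub0r normrN ger0_norm ?invr_ge0// invf_plt ?posrE ?ltr0n//.
  apply: (@lt_le_trans _ _ N%:R); last by rewrite ler_nat.
  by near: N; exact: nbhs_infty_gtr.
have linv A : l (tau @^-1` A) = l A.
  apply/eqP; rewrite -subr_eq0 -normr_le0.
  have h : (fun N => `|mu (nn N) (tau @^-1` A) - mu (nn N) A|) @ U -->
      `|l (tau @^-1` A) - l A|.
    by apply: cvg_norm; apply: cvgB; exact: hl.
  by apply: ler_cvg_to h inv_nn _; apply: nearW => N; exact: mu_invariant.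
have [m [mK mG mtau]] := finitely_additive_invariant_measure (t0 := t0) dT cT lM ctau linv.
have e20 : 0 < e / 2 by rewrite divr_gt0.
(* The radii are chosen once [m] is known, so that the spheres are [m]-null; being below [e / 2],
   they put points with equal labels at distance less than [e]. *)
have [r hr] := choice (fun x => null_sphere m x dT e20).
have [| |s hs] := compact_finite_cover (f := fun x => [set y | d x y < r x]) cT.
- by move=> x; exact: open_dball dT _ _.
- by move=> x _; exists x => /=; rewrite (distxx dT); case: (hr x).
pose W (i : 'I_(size s)) := let x := tnth (in_tuple s) i in [set y | d x y < r x].
pose f (y : T) := [ffun i : 'I_(size s) => `[< W i y >]].
have fe x y : f x = f y -> d x y < e.
  move=> fxy; have [z zs zx] := hs x I.
  have zi : (index z s < size s)%N by rewrite index_mem.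
  have Wz t : W (Ordinal zi) t <-> d z t < r z.
    by rewrite /W (tnth_nth z)/= nth_index.
  have zy : d z y < r z.
    apply/Wz/asboolP; move/ffunP/(_ (Ordinal zi)) : fxy; rewrite !ffunE => <-.
    by apply/asboolP/Wz.
  have [_ rz _] := hr z; have := dist_triangle dT x z y.
  by rewrite (dist_sym dT x z); move: zx => /=; lra.
have CM := continuity_set_fa m lM.
have Cf : label (continuity_set m) f.
  apply: (label_membership CM) => i; rewrite /W /=.
  set x := tnth _ _; have [_ _ r0] := hr x; split.
    by apply: open_borel; exact: open_dball dT _ _.
  exists [set y | d x y < r x], [set y | d x y <= r x]; split => //.
  - exact: open_dball dT _ _.
  - exact: closed_dball dT _ _.
  - by move=> y /= /ltW.
  - rewrite -[RHS]r0; congr (m _); apply/seteqP; split => y /=.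
      by case=> yr /negP; rewrite -leNgt => ry; apply/eqP; rewrite eq_le yr.
    by move=> ->; split => //; rewrite ltxx.
have Ctau (A : set T) : continuity_set m A -> continuity_set m (tau @^-1` A).
  exact: continuity_set_preimage.
have Mf : label (@measurable _ (borelType t0)) f by move=> w; case: (Cf w).
have mS (A : set (borelType t0)) : measurable A ->
    measurable (tau @^-1` A : set (borelType t0)) by exact: continuous_borel.
(* Itinerary cells are continuity sets, so the limit entropy is that of a genuine invariant
   measure. *)
have lE q : entropy l (itinerary tau f q) = entropy (realprob m) (itinerary tau f q).
  apply: eq_bigr => w _; congr eta; apply: (continuity_setE lM mK mG).
  exact: (label_itinerary CM Ctau).
apply: (@le_trans _ _ (rate (realprob m) tau f)%:E); last first.
  apply: le_trans (KS_entropy_ge mS mtau Mf) _.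
  by apply: ereal_sup_ubound; right; exists t0, m.
rewrite lee_fin; apply: (rate_ge (realprob_fa m) mS (realprobS mtau)) => //.
move=> q q0; rewrite -lE.
have cH : (fun N => entropy (mu (nn N)) (itinerary tau f q)) @ U -->
    entropy l (itinerary tau f q).
  apply: cvg_big => [|w _]; first exact: add_continuous.
  apply: (@continuous_eta R _ _ U (fun N => mu (nn N) _)) => //.
  - by rewrite inE /=; exact: (fa_ge0 lM).
  - by move=> N; case/andP: (mu01 (itinerary tau f q @^-1` [set w]) N).
have cB : (fun N => q%:R * (q%:R * ln #|{ffun 'I_(size s) -> bool}|%:R) * (nn N)%:R^-1 +
    entropy (mu (nn N)) (itinerary tau f q)) @ U -->
    q%:R * (q%:R * ln #|{ffun 'I_(size s) -> bool}|%:R) * 0 + entropy l (itinerary tau f q).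
  by apply: cvgD => //; exact: cvgMr.
rewrite mulr0 add0r in cB.
apply: ler_cvg_to (cvg_cst (q%:R * b)) cB _.
apply: oU; near=> N.
apply: entropy_mu_block => //; apply: dvdn_fact; rewrite q0/=; apply: leqW.
by near: N; exact: nbhs_infty_ge.
Unshelve. all: by end_near. Qed.

End Misiurewicz.

(** * Covers by few Bowen balls *)

Section VariationalCover.
Context {R : realType} {T : topologicalType}.
Variable d : T -> T -> R.
Hypothesis dT : compatible_distance d.
Hypothesis cT : compact [set: T].
Variable tau : T -> T.
Hypothesis ctau : continuous tau.

(** If no such cover exists, points can be added greedily to an (n, e / 2)-separated set until there
    are more than [expR (a * n)] of them, for every [n]; [misiurewicz] then gives entropy at least
    [a]. Two points of a Bowen ball of radius [e / 2] stay within [e]. *)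
Lemma variational_cover (a e : R) : (topological_entropy R tau < a%:E)%E ->
  0 < e -> exists n N (E : 'I_N -> set T),
  [/\ (0 < n)%N, N%:R <= expR (a * n%:R),
   forall i x y k, (k < n)%N -> E i x -> E i y ->
     d (iter k tau x) (iter k tau y) < e & forall x, exists i, E i x].
Proof.
move=> ha e0; have [[t0 _]|nT] := pselect (exists t : T, True); last first.
  exists 1%N, 0%N, (fun=> set0); split => //; first exact: expR_ge0.
  by move=> x; exfalso; apply: nT; exists x.
apply: contrapT => H.
have e20 : 0 < e / 2 by rewrite divr_gt0.
(* The extra 1 admits the first integer above [expR (a * n)]. *)
have sep n : (0 < n)%N -> forall m, m%:R <= expR (a * n%:R) + 1 ->
    exists p : nat -> T, forall i j, (i < j)%N -> (j < m)%N ->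
    exists2 k, (k < n)%N & e / 2 <= d (iter k tau (p i)) (iter k tau (p j)).
  move=> n0; elim => [_|m IH mC]; first by exists (fun=> t0).
  have mC' : m%:R <= expR (a * n%:R) by move: mC; rewrite -natr1 lerD2r.
  have [|p hp] := IH; first by apply: le_trans mC' _; rewrite lerDl.
  have [x hx] : exists x, forall i : 'I_m, exists2 k, (k < n)%N &
      e / 2 <= d (iter k tau (p i)) (iter k tau x).
    apply: contrapT => nx; apply: H.
    exists n, m, (fun i : 'I_m => [set x | forall k, (k < n)%N ->
      d (iter k tau (p i)) (iter k tau x) < e / 2]); split => //.
      move=> i x y k kn /(_ k kn) h1 /(_ k kn) h2.
      have := dist_triangle dT (iter k tau x) (iter k tau (p i)) (iter k tau y).
      by rewrite (dist_sym dT (iter k tau x) (iter k tau (p i))); lra.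
    move=> x; apply: contrapT => ni; apply: nx; exists x => i.
    apply: contrapT => nk; apply: ni; exists i => k kn; rewrite ltNge.
    by apply/negP => h; apply: nk; exists k.
  exists (fun i => if i == m then x else p i) => i j ij jm.
  rewrite (ltn_eqF (leq_trans ij jm)).
  have [jE|jm'] := eqVneq j m; last by apply: hp => //; rewrite ltn_neqAle jm'.
  rewrite jE in ij.
  exact: (hx (Ordinal ij)).
have exp n : exists pm : (nat -> T) * nat, (0 < pm.2)%N /\ ((0 < n)%N ->
    n%:R * a <= ln pm.2%:R /\
    forall i j, (i < pm.2)%N -> (j < pm.2)%N ->
    (forall k, (k < n)%N ->
       d (iter k tau (pm.1 i)) (iter k tau (pm.1 j)) < e / 2) -> i = j).
  have [->|n0] := posnP n; first by exists (fun=> t0, 1%N).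
  have /andP[tr1 tr2] := truncn_itv (expR_ge0 (a * n%:R)).
  have [|p hp] := sep n n0 (Num.truncn (expR (a * n%:R))).+1.
    by rewrite -natr1 lerD2r.
  exists (p, (Num.truncn (expR (a * n%:R))).+1); split => //= _; split.
    by rewrite mulrC -[leLHS](@expRK R) ler_ln ?posrE ?expR_gt0 ?ltr0n// ltW.
  move=> i j im jm h; have [ij|ji|//] := ltngtP i j.
    by have [k kn] := hp i j ij jm; rewrite leNgt h.
  by have [k kn] := hp j i ji im; rewrite leNgt (dist_sym dT) h.
have [pm hpm] := choice exp.
have := @misiurewicz R T t0 d dT cT tau ctau (e / 2) a (fun n => (pm n).1)
  (fun n => (pm n).2) e20 (fun n => (hpm n).1)
  (fun n n0 => ((hpm n).2 n0).1) (fun n i j n0 => ((hpm n).2 n0).2 i j).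
by rewrite leNgt ha.
Qed.

End VariationalCover.

(** * Bowen entropy *)

Lemma compact_separation (R : realType) (Z : topologicalType) (d : Z -> Z -> R)
    (I : finType) (K : I -> set Z) :
  compatible_distance d -> (forall i, compact (K i)) ->
  (forall i j x, K i x -> K j x -> i = j) ->
  exists2 e : R, 0 < e &
    forall i j x y, K i x -> K j y -> d x y < e -> i = j.
Proof.
move=> dZ cK dK; have clK i : closed (K i).
  by apply: compact_closed (cK i); exact: dist_hausdorff dZ.
have h i : \forall e \near (0 : R)^'+, forall j x y, K i x -> K j y ->
    d x y < e -> i = j.
  pose s := [seq j <- enum I | j != i].
  have oU : open (~` \bigcup_(j in [set` s]) K j).
    by rewrite bigcup_seq; apply: closed_openC; apply: closed_bigsetU.
  have [|e e0 he] := compact_uniform_dball dZ (cK i) oU.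
    move=> x Kx [j]; rewrite /= mem_filter => /andP[/eqP ji _] Kj.
    exact/ji/(dK _ _ x).
  near=> r => j x y Kx Ky xy; apply: contrapT => ij.
  apply: (he x y Kx); first by apply: lt_trans xy _; near: r; exact: nbhs_right_lt.
  by exists j => //=; rewrite mem_filter mem_enum andbT; apply/eqP => ji; exact: ij.
have h' := filter_forall _ h.
near (0 : R)^'+ => e; exists e; first by [].
by near: e; exact: h'.
Unshelve. all: by end_near. Qed.

Lemma one_point_distance_compatible (R : realType) (X : topologicalType)
    (dX : X -> X -> R) : one_point_distance dX -> compatible_distance dX.
Proof.
move=> [D [DX dE]]; split.
  split=> [x y|x y|x y|x y z]; rewrite !dE.
  - exact: dist_ge0 DX _ _.
  - by split => [/(dist_eq0 DX)[]//|->]; exact: distxx DX _.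
  - exact: dist_sym DX _ _.
  - exact: dist_triangle DX _ _ _.
move=> x A; split => [xA|[e e0 eA]].
  have /(dist_nbhs DX)[e e0 eA] :=
    @one_point_compactification_some_nbhs X x A xA.
  exists e => // y /=; rewrite dE => xy.
  by have [z Az [<-]] := eA (Some y) xy.
have h : nbhs x [set y | D (Some x) (Some y) < e].
  exact: (nbhs_dball DX (Some x : one_point_compactification X) e0).
by apply: filterS h => y /= xy; apply: eA; rewrite /= dE.
Qed.

Section BowenEntropy.
Context {R : realType} {Z : choiceType}.
Variables (d : Z -> Z -> R) (S : Z -> Z) (K : set Z).
Local Open Scope ereal_scope.

Lemma spanning_number_ge0 n e : 0 <= spanning_number d S n e K.
Proof. by apply: le_ereal_inf_tmp => _ [m _ <-]; rewrite lee_fin. Qed.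

Lemma spanning_number_le n e e' : (e <= e')%R ->
  spanning_number d S n e' K <= spanning_number d S n e K.
Proof.
move=> ee'; apply: ereal_inf_le_tmp => _ [m [F [Fm sF]] <-]; exists m => //.
exists F; split => // x /sF[z Fz h]; exists z => // k kn.
exact: lt_le_trans (h k kn) ee'.
Qed.

(** Spanning numbers grow as [e] decreases, so the limit at 0 is a supremum and the upper growth
    rate at each scale is below [b]; one large [n] suffices. *)
Lemma bowen_entropy_spanning (b e : R) : bowen_entropy d S K < b%:E ->
  (0 < e)%R -> exists n m (F : set Z), [/\ (0 < n)%N, (F #= `I_m)%card,
    (m%:R <= expR (b * n%:R))%R & spanning_set d S n e K F].
Proof.
move=> hb e0; pose u e n := n%:R^-1%:E * lne (spanning_number d S n e K).
have monu : {in Interval (BRight (0%R : R)) (BInfty R false) &,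
    {homo (fun e => limn_esup (u e)) : x y / (x <= y)%R >-> y <= x}}.
  move=> x y _ _ xy; rewrite /limn_esup /limf_esup.
  apply: le_ereal_inf_tmp => _ [V FV <-].
  apply: (@le_trans _ _ (ereal_sup [set u y n | n in V])).
    by apply: ereal_inf_lbound; exists V.
  apply: ge_ereal_sup => _ [n Vn <-].
  apply: (@le_trans _ _ (u x n)); last by apply: ereal_sup_ubound; exists n.
  rewrite /u lee_wpmul2l ?lee_fin// lee_lne ?in_itv/= ?leey ?andbT ?spanning_number_ge0//.
  exact: spanning_number_le.
have := nonincreasing_at_right_cvge (BInfty R false) isT monu.
move=> /cvg_lim h; rewrite /bowen_entropy h// in hb.
have : limn_esup (u e) < b%:E.
  apply: le_lt_trans hb; apply: ereal_sup_ubound; exists e => //=.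
  by rewrite in_itv/= e0.
move=> /ereal_inf_lt[_ [V [N _ NV] <-] hV].
have uN : u e N.+1 < b%:E.
  apply: le_lt_trans hV; apply: ereal_sup_ubound; exists N.+1 => //.
  by apply: NV => /=.
have N0 : (0 < N.+1%:R :> R)%R by [].
have : spanning_number d S N.+1 e K < (expR (b * N.+1%:R))%:E.
  move: uN (spanning_number_ge0 N.+1 e); rewrite /u.
  case: (spanning_number _ _ _ _ _) => [r| |]//=.
    (* A spanning number 0 has logarithm -oo and satisfies the bound trivially. *)
    case: ifPn => [r0 _ _|]; first by rewrite lte_fin (le_lt_trans r0)// expR_gt0.
    rewrite -ltNge => r0; rewrite -EFinM !lte_fin mulrC ltr_pdivrMr// => h1 _.
    by rewrite -[ltLHS](@lnK R) ?posrE// ltr_expR.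
  by rewrite gt0_muley ?lte_fin ?invr_gt0// => /ltW; rewrite leye_eq.
move=> /ereal_inf_lt[_ [m [F [Fm sF]] <-]]; rewrite lte_fin => mb.
by exists N.+1, m, F; split => //; exact: ltW.
Qed.

End BowenEntropy.

Lemma card_eq_enum (Z : Type) (F : set Z) (m : nat) (z0 : Z) :
  (F #= `I_m)%card -> exists f : nat -> Z, forall z, F z -> exists2 i, (i < m)%N & f i = z.
Proof.
rewrite card_eq_le => /andP[/pfcard_geP[->|/surjfunPex[f ->]] _].
  by exists (fun=> z0).
by exists f => _ [i /= im <-]; exists i.
Qed.

(** With [e] the separation of the compacts, orbits in one Bowen ball of radius [e / 2] cannot visit
    different compacts at the same time. *)
Lemma safe_covers_spanning (R : realType) (X : topologicalType) (d : X -> X -> R)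
    (I : finType) (phi : X -> X) (K : I -> set X) (b : R) (Q : set X) :
  compatible_distance d -> (forall i, compact (K i)) ->
  (forall i j x, K i x -> K j x -> i = j) ->
  (bowen_entropy d phi Q < b%:E)%E -> safe_covers phi K b Q.
Proof.
move=> dX cK dK hb; have [e e0 he] := compact_separation dX cK dK.
have e20 : 0 < e / 2 by rewrite divr_gt0.
have [n [m [F [n0 Fm mb sF]]]] := bowen_entropy_spanning hb e20.
have [[x0 _]|nX] := pselect (exists x : X, True); last first.
  exists 1%N, 0%N, (fun=> set0); split => //; [exact: expR_ge0|by case|].
  by move=> x; exfalso; apply: nX; exists x.
have [f hf] := card_eq_enum x0 Fm.
exists n, m, (fun i : 'I_m => [set x | forall k, (k < n)%N ->
  d (iter k phi x) (iter k phi (f i)) < e / 2]); split => //.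
  move=> l k i j x y kn /(_ _ kn) h1 /(_ _ kn) h2 Ki Kj.
  apply: (he i j _ _ Ki Kj).
  apply: le_lt_trans (dist_triangle dX _ (iter k phi (f l)) _) _.
  by rewrite (splitr e) ltrD// (dist_sym dX).
move=> x Qx; have [z Fz h] := sF x Qx.
have [i im fi] := hf z Fz; exists (Ordinal im) => //= k kn; rewrite fi.
exact: h.
Qed.

(** * Principal bundles *)

Section PrincipalBundle.
Context {R : realType} {T : topologicalGroupType} {X Y : topologicalType}.
Variables (act : X -> T -> X) (pi : X -> Y).
Hypotheses (cT : compact [set: T]) (pb : principal_bundle act pi).
Variable d : X -> X -> R.
Hypothesis dX : compatible_distance d.

Lemma act_inj x s t : act x s = act x t -> s = t.
Proof.
move=> e; have st : (s * t^-1)%g = 1%g.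
  by apply: (pb_free pb (x := x)); rewrite -(pb_actM pb) e (pb_actM pb) mulgV (pb_act1 pb).
by rewrite -[s]mulg1 -(mulVg t) mulgA st mul1g.
Qed.

Lemma act_continuous x : continuous (act x).
Proof.
move=> t; apply: (@continuous_comp _ _ _ (fun t => (x, t)) (fun p => act p.1 p.2)).
  by apply: cvg_pair => /=; [exact: cvg_cst|exact: cvg_id].
exact: (pb_continuous pb).
Qed.

(* By compactness of [T], the orbit map is an embedding. *)
Lemma orbit_distance x : compatible_distance (fun s t : T => d (act x s) (act x t)).
Proof.
split.
  split=> [s t|s t|s t|s t u].
  - exact: dist_ge0 dX _ _.
  - by split => [/(dist_eq0 dX)/act_inj//|->]; exact: distxx dX _.
  - exact: dist_sym dX _ _.
  - exact: dist_triangle dX _ _ _.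
move=> t A; split => [tA|[e e0 eA]]; last first.
  apply: filterS eA _.
  exact: (act_continuous (nbhs_dball dX (act x t) e0)).
have cC : compact (act x @` ~` A^°).
  apply: continuous_compact.
    by apply: continuous_subspaceT => s; exact: act_continuous.
  apply: (subclosed_compact _ cT) => //.
  by apply: open_closedC; exact: open_interior.
have oC : open (~` (act x @` ~` A^°)).
  by apply: closed_openC; apply: compact_closed cC; exact: dist_hausdorff dX.
have nC : (~` (act x @` ~` A^°)) (act x t).
  by move=> [s /= sA /act_inj st]; apply: sA; rewrite st.
have /(dist_nbhs dX)[e e0 eC] : nbhs (act x t) (~` (act x @` ~` A^°)).
  by apply: open_nbhs_nbhs; split.
exists e => // s /eC /= nCs; apply: interior_subset; apply: contrapT => sA.
by apply: nCs; exists s.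
Qed.

Variables (phi : X -> X) (tau : T -> T).
Hypothesis phi_cont : continuous phi.
Hypothesis phi_act : forall x t, phi (act x t) = act (phi x) (tau t).

(** [phi \o act x] equals [act (phi x) \o tau], and the orbit map of [phi x] is an embedding. *)
Lemma tau_continuous (x : X) : continuous tau.
Proof.
move=> t A /(dist_nbhs (orbit_distance (phi x)))[e e0 eA].
apply: filterS (_ : nbhs t [set s | d (phi (act x t)) (phi (act x s)) < e]).
  by move=> s /=; rewrite !phi_act => h; exact: eA.
have h := nbhs_dball dX (phi (act x t)) e0.
exact: (act_continuous (phi_cont h)).
Qed.

Lemma iter_phi_act k x t : iter k phi (act x t) = act (iter k phi x) (iter k tau t).
Proof. by elim: k => [//|k IH]; rewrite !iterS IH phi_act. Qed.

(** The separation of the compacts is translated into a neighbourhood of the identity, uniform over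
    all base points in them. *)
Lemma compact_act_separation (I : finType) (K : I -> set X) :
  (forall i, compact (K i)) -> (forall i j x, K i x -> K j x -> i = j) ->
  exists2 W : set T, nbhs 1%g W &
    forall i j x w, K i x -> W w -> K j (act x w) -> i = j.
Proof.
move=> cK dK; have [e e0 he] := compact_separation dX cK dK.
have h i : \forall w \near (1%g : T), K i `<=` (fun x => d x (act x w) < e).
  move: (cK i) => /compact_near_coveringP; apply => x Kx.
  have e20 : 0 < e / 2 by rewrite divr_gt0.
  have h1 : nbhs (act x 1%g) [set y | d x y < e / 2].
    by rewrite (pb_act1 pb); exact: (nbhs_dball dX x e20).
  have cact : continuous (fun p : X * T => act p.1 p.2) := pb_continuous pb.
  have := cact (x, 1%g) _ h1.
  move=> [[A B] /= [xA oneB] AB].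
  exists ([set y | d x y < e / 2] `&` A, B).
    by split => //=; exact: filterI (nbhs_dball dX x e20) xA.
  move=> [y w] [/= [xy Ay] Bw].
  have /= yw := AB (y, w) (conj Ay Bw).
  have := dist_triangle dX y x (act y w); rewrite (dist_sym dX y x); lra.
exists [set w | forall i x, K i x -> d x (act x w) < e].
  exact: (filter_forall _ h).
move=> i j x w Kx Ww Kxw; apply: (he i j _ _ Kx Kxw); exact: Ww Kx.
Qed.

(** Uniform continuity on the compact group: [s^-1 * t] is close to 1 as soon as [s] and [t] are
    close, wherever they are. *)
Lemma orbit_distance_mulV (x : X) (W : set T) : nbhs 1%g W ->
  exists2 e : R, 0 < e & forall s t, d (act x s) (act x t) < e ->
    W (s^-1 * t)%g.
Proof.
move=> W1; have dT := orbit_distance x.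
have : \forall e \near (0 : R)^'+, [set: T] `<=` (fun s => forall t,
    d (act x s) (act x t) < e -> W (s^-1 * t)%g).
  move: cT => /compact_near_coveringP; apply => s _.
  have cdiv : {for (s, s), continuous (fun p : T * T => (p.1^-1 * p.2)%g)}.
    have cinv : {for (s, s), continuous (fun p : T * T => p.1^-1%g)}.
      apply: (@continuous_comp _ _ _ fst (fun s => s^-1%g)); first exact: cvg_fst.
      exact: invg_continuous.
    apply: (@continuous_comp _ _ _ (fun p : T * T => (p.1^-1%g, p.2))
      (fun p => (p.1 * p.2)%g)); last exact: mulg_continuous.
    by apply: cvg_pair => /=; [exact: cinv|exact: cvg_snd].
  have W1' : nbhs ((s, s).1^-1 * (s, s).2)%g W by rewrite /= mulVg.
  have [[A B] /= [sA sB] AB] := cdiv _ W1'.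
  have /(dist_nbhs dT)[r r0 rAB] : nbhs s (A `&` B) by exact: filterI.
  have r20 : 0 < r / 2 by rewrite divr_gt0.
  exists ([set t | d (act x s) (act x t) < r / 2], [set e | e < r / 2]).
    by split => /=; [exact: (nbhs_dball dT s r20)|exact: nbhs_right_lt].
  move=> [s' e] [/= ss' er] t s't.
  have [As' _] : (A `&` B) s' by apply: rAB => /=; lra.
  have [_ Bt] : (A `&` B) t.
    apply: rAB => /=; apply: le_lt_trans (dist_triangle dT _ s' _) _ => /=; lra.
  exact: (AB (s', t)).
move=> h; near (0 : R)^'+ => e; exists e; first by [].
by move=> s t; apply: (near h e _ s I t).
Unshelve. all: by end_near. Qed.

(** At time [k] the fibre of [x0] has moved to the orbit of [iter k phi x0]. The iterates of two of
    its points differ by the translation [(iter k tau s)^-1 * iter k tau t], and its size is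
    controlled by distances in the orbit of [x0] alone. *)
Lemma safe_covers_bundle (I : finType) (K : I -> set X) (b : R) (y : Y) :
  (forall i, compact (K i)) -> (forall i j x, K i x -> K j x -> i = j) ->
  (topological_entropy R tau < b%:E)%E ->
  safe_covers phi K b (pi @^-1` [set y]).
Proof.
move=> cK dK hb; have [x0 <-] := pb_surjective pb y.
have [W W1 hW] := compact_act_separation cK dK.
have [e e0 he] := orbit_distance_mulV x0 W1.
have [n [N [E [n0 Nb hE cE]]]] :=
  variational_cover (orbit_distance x0) cT (tau_continuous x0) hb e0.
exists n, N, (fun l => act x0 @` E l); split => //.
  move=> l k i j _ _ kn [s Es <-] [t Et <-]; rewrite !iter_phi_act => Ki Kj.
  apply: (hW i j _ ((iter k tau s)^-1 * iter k tau t)%g Ki).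
    exact: he (hE l s t k kn Es Et).
  by rewrite (pb_actM pb) mulgA mulgV mul1g.
rewrite (pb_fiber pb) => _ [t _ <-]; have [l El] := cE t.
by exists l => //; exists t.
Qed.

End PrincipalBundle.

(** Covers exist only for exponents strictly above [s]; when [s] is +oo the right side is +oo,
    because [h'] is nonnegative. *)
Lemma le_entropy_addP (R : realType) (h h' s : \bar R) :
  (0 <= h')%E -> (0 <= s)%E ->
  (forall b : R, (s < b%:E)%E -> (h <= h' + b%:E)%E) -> (h <= h' + s)%E.
Proof.
move=> h'0; case: s => [r| |]// _ H.
  apply/lee_addgt0Pr => e e0; rewrite -addeA -EFinD; apply: H.
  by rewrite lte_fin ltrDl.
by rewrite addey ?leey// gt_eqF// (lt_le_trans _ h'0)// ltNy0.
Qed.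

Unset Implicit Arguments.

Theorem proposition6p1 (R : realType) (X Y : topologicalType)
    (HX : sep_lc_metrizable R X) (HY : sep_lc_metrizable R Y)
    (phi : X -> X) (varphi : Y -> Y) (pi : X -> Y)
    (phi_cont : continuous phi) (phi_proper : proper_map phi)
    (varphi_cont : continuous varphi) (varphi_proper : proper_map varphi)
    (pi_cont : continuous pi) (pi_proper : proper_map pi)
    (semiconj : pi \o phi = varphi \o pi) :
  (forall dX : X -> X -> R, one_point_distance dX ->
     (topological_entropy R phi <= topological_entropy R varphi +
        nneg_ereal_sup [set bowen_entropy dX phi (pi @^-1` [set y])
                   | y in [set: Y]])%E)
  /\
  (forall (T : topologicalGroupType) (act : X -> T -> X),
     compact [set: T] -> principal_bundle act pi ->
     forall tau : T -> T,
       (forall (x : X) (t : T), phi (act x t) = act (phi x) (tau t)) ->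
       (topological_entropy R phi <=
          topological_entropy R varphi + topological_entropy R tau)%E).
Proof.
have ge0 (Z : topologicalType) (S : Z -> Z) : (0 <= topological_entropy R S)%E.
  by apply: ereal_sup_ubound; left.
split.
  move=> dX /one_point_distance_compatible cdX.
  have s0 : (0 <= nneg_ereal_sup [set bowen_entropy dX phi (pi @^-1` [set y])
      | y in [set: Y]])%E by apply: ereal_sup_ubound; left.
  apply: le_entropy_addP => // b sb.
  apply: (topological_entropy_fiber_le HX HY) => //.
    by rewrite -lee_fin ltW// (le_lt_trans s0).
  move=> k K cK dK y; apply: (safe_covers_spanning cdX) => //.
  apply: le_lt_trans sb; apply: ereal_sup_ubound; right.
  by exists y.
move=> T act cT pb tau phi_act; apply: le_entropy_addP => // b sb.
apply: (topological_entropy_fiber_le HX HY) => //.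
  by rewrite -lee_fin ltW// (le_lt_trans (ge0 _ tau)).
have [_ _ [d dX]] := HX.
by move=> k K cK dK y; exact: (safe_covers_bundle cT pb dX phi_cont phi_act).
Qed.
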